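(* Let $M$ be a graded $S$-module with finite projective dimension and let $a\in\mathbb{Z}$. If there exists a Betti-deficient differential module $D\in\mathrm{DM}(S,a)$ with $H(D) = M$, then the Betti table for $M$ must have two nonzero entries (in nonadjacent columns) lying on a line of slope $1-a + \frac{a}{j}$ for some $j\geq 2$.
   Context: $S$ is a Noetherian graded-local ring: an $\mathbb{N}$-graded ring (possibly concentrated in degree $0$) whose degree $0$ component is local, with residue field $\Bbbk$. All modules are finitely generated. A differential module $(D,d)$ is an $S$-module $D$ with an $S$-endomorphism $d$ such that $d^2=0$. It is of degree $a$ if $D$ is graded and $d\colon D\to D(a)$ is a graded map; its homology is $H(D)=\ker(d)/\operatorname{im}(d(-a))$. Morphisms are graded $S$-module maps commuting with the endomorphisms, a quasi-isomorphism is a morphism inducing an isomorphism on homology, and $\mathrm{DM}(S,a)$ is the category of degree $a$ differential modules. $D$ is free if the underlying module is free, and minimal if $d\otimes_S\Bbbk=0$. A free flag is a differential module $D$ with a splitting $D=\bigoplus_{i\in\mathbb{Z}}G_i$, each $G_i$ free, $G_i=0$ for $i<0$, and $d(G_i)\subseteq\bigoplus_{j<i}G_j$. A minimal free resolution of $D$ (in the sense of Brown–Erman) is a quasi-isomorphism $F\to D$ with $F$ free and minimal that factors as a split injection of $F$ into a free flag $G$ followed by a quasi-isomorphism $G\to D$. The $j$-th Betti number of $D$ is $\beta_j(D)=\dim_\Bbbk H(F\otimes_S\Bbbk)_j$ for any minimal free resolution $F$ of $D$, and the total Betti number is $\beta(D)=\sum_{j\in\mathbb{Z}}\beta_j(D)$.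 $D$ is Betti-deficient if $\beta(D)<\beta(H(D))$, where $H(D)$ is viewed as a differential module with $0$ endomorphism; $\beta(H(D))$ equals the sum of the Betti numbers of the module $H(D)$. Betti table of $M$: if the minimal graded free resolution of $M$ has $F_i=\bigoplus_k S(-k)^{\beta_{i,k}}$, the entry $\beta_{i,k}$ is placed in column $i$ and row $k-i$. Columns are numbered left to right and rows are numbered from top to bottom, and slope is in the usual visual sense (upward is positive), so entries in columns $i,i'$ and rows $r,r'$ ($i\ne i'$) lie on a line of slope $-(r'-r)/(i'-i)$. *)

(* Defs.v *)
From HB Require Import structures.
From mathcomp Require Import all_boot all_order all_algebra.
From mathcomp Require Import boolp classical_sets.

Set Implicit Arguments.
Unset Strict Implicit.
Unset Printing Implicit Defensive.

Import GRing.Theory.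
Local Open Scope ring_scope.
Local Open Scope quotient_scope.

Definition fin_sum (I : eqType) (V : nmodType) (w : I -> V) (v : V) : Prop :=
  exists s : seq I,
    [/\ uniq s, forall i, i \notin s -> w i = 0 & v = \sum_(i <- s) w i].

Definition decomposes (I : eqType) (V : zmodType) (G : I -> set V)
    (v : V) (w : I -> V) : Prop :=
  (forall i, G i (w i)) /\ fin_sum w v.

Record direct_sum (I : eqType) (V : zmodType) (G : I -> set V) : Prop :=
  DirectSum {
    direct_sum0 : forall i, G i 0;
    direct_sumB : forall i x y, G i x -> G i y -> G i (x - y);
    direct_sum_dec : forall v, exists! w, decomposes G v w }.

Section Components.
Variables (I : eqType) (V : zmodType) (G : I -> set V) (dG : direct_sum G).

Lemma fin_sum_eq (U : nmodType) (w : I -> U) s t :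
  uniq s -> uniq t -> (forall i, i \notin s -> w i = 0) ->
  (forall i, i \notin t -> w i = 0) ->
  \sum_(i <- s) w i = \sum_(i <- t) w i.
Proof.
move=> us ut ws wt.
have nz r : \sum_(i <- r) w i = \sum_(i <- r | w i != 0) w i.
  rewrite [RHS]big_mkcond; apply: eq_bigr => i _.
  by case: eqP.
rewrite nz [RHS]nz -big_filter -[RHS]big_filter; apply: perm_big.
apply: uniq_perm; rewrite ?filter_uniq // => i; rewrite !mem_filter.
case: (altP (w i =P 0)) => //= wi0.
have -> : i \in s by apply: contraNT wi0 => /ws ->.
by apply/esym; apply: contraNT wi0 => /wt ->.
Qed.

Definition component (v : V) : I -> V := sval (cid (direct_sum_dec dG v)).

Lemma componentP v : decomposes G v (component v).
Proof. by rewrite /component; case: (cid _) => w []. Qed.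

Lemma component_in v i : G i (component v i).
Proof. by case: (componentP v). Qed.

Lemma component_uniq v w : decomposes G v w -> component v = w.
Proof. by rewrite /component; case: (cid _) => w' /= [_ h] /h. Qed.

Lemma component_sum v : fin_sum (component v) v.
Proof. by case: (componentP v). Qed.

Lemma fin_sumB (w1 w2 : I -> V) v1 v2 : fin_sum w1 v1 -> fin_sum w2 v2 ->
  fin_sum (fun i => w1 i - w2 i) (v1 - v2).
Proof.
move=> [s1 [u1 z1 ->]] [s2 [u2 z2 ->]].
have nin i : i \notin undup (s1 ++ s2) -> (i \notin s1) * (i \notin s2).
  by rewrite mem_undup mem_cat negb_or => /andP[-> ->].
exists (undup (s1 ++ s2)); split=> [|i /nin ni|]; first exact: undup_uniq.
  by rewrite z1 ?z2 ?ni // subrr.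
rewrite sumrB; congr (_ - _); apply: fin_sum_eq => //; rewrite ?undup_uniq //.
  by move=> i /nin ni; rewrite z1 ?ni.
by move=> i /nin ni; rewrite z2 ?ni.
Qed.

Lemma componentB u v i : component (u - v) i = component u i - component v i.
Proof.
rewrite (@component_uniq _ (fun j => component u j - component v j)) //.
split; first by move=> j; apply: (direct_sumB dG); exact: component_in.
by apply: fin_sumB; apply: component_sum.
Qed.

Lemma component0 i : component 0 i = 0.
Proof. by have := componentB 0 0 i; rewrite !subrr. Qed.

Lemma componentD u v i : component (u + v) i = component u i + component v i.
Proof.
have -> : u + v = u - (0 - v) by rewrite sub0r opprK.
by rewrite !componentB component0 sub0r opprK.
Qed.

Lemma component_big (J : Type) (r : seq J) (P : pred J) (f : J -> V) i :
  component (\sum_(j <- r | P j) f j) i = \sum_(j <- r | P j) component (f j) i.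
Proof.
elim/big_rec2: _ => [|j x y _ <-]; first exact: component0.
exact: componentD.
Qed.

Lemma component_hom i x j : G i x -> component x j = if j == i then x else 0.
Proof.
move=> Gx; pose w k := if k == i then x else 0.
rewrite (@component_uniq _ w) //; split.
  by move=> k; rewrite /w; case: eqP => [->//|_]; apply: (direct_sum0 dG).
exists [:: i]; split=> // [k|]; first by rewrite /w inE => /negbTE ->.
by rewrite big_seq1 /w eqxx.
Qed.

End Components.

Record gring := GradedRing {
  gring_sort :> comNzRingType;
  rgr : nat -> set gring_sort;
  rgr_sum : direct_sum rgr;
  rgr1 : rgr 0%N 1;
  rgrM : forall m n x y, rgr m x -> rgr n y -> rgr (m + n)%N (x * y) }.

Record gmod (S : gring) := GradedMod {
  gmod_sort :> lmodType S;
  gr : int -> set gmod_sort;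
  gr_sum : direct_sum gr;
  grZ : forall m n (s : S) v, rgr m s -> gr n v -> gr (m%:Z + n) (s *: v) }.

Definition rcomp (S : gring) (x : S) (n : nat) : S := component (rgr_sum S) x n.
Definition mcomp (S : gring) (V : gmod S) (v : V) (n : int) : V :=
  component (gr_sum V) v n.

Lemma mcompZ (S : gring) (V : gmod S) (m : nat) (s : S) (v : V) n :
  rgr m s -> mcomp (s *: v) n = s *: mcomp v (n - m%:Z).
Proof.
move=> ms; rewrite /mcomp.
rewrite (@component_uniq _ _ _ (gr_sum V) _
  (fun k => s *: component (gr_sum V) v (k - m%:Z))) //.
split=> [k|].
  have {1}-> : k = m%:Z + (k - m%:Z) by rewrite addrC subrK.
  by apply: grZ => //; apply: component_in.
have [r [ur zr ev]] := component_sum (gr_sum V) v.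
exists [seq i + m%:Z | i <- r]; split.
- by rewrite map_inj_uniq // => i j /addIr.
- move=> i /mapP ni /=; rewrite zr ?scaler0 //; apply/negP => ri; apply: ni.
  by exists (i - m%:Z); rewrite ?subrK.
- rewrite {1}ev big_map scaler_sumr; apply: eq_bigr => i _.
  by rewrite addrK.
Qed.

Lemma rcomp0M (S : gring) (x y : S) : rcomp (x * y) 0 = rcomp x 0 * rcomp y 0.
Proof.
rewrite /rcomp.
have [r [ur zr ex]] := component_sum (rgr_sum S) x.
have [t [ut zt ey]] := component_sum (rgr_sum S) y.
rewrite {1}ex {1}ey mulr_suml component_big.
have cin := component_in (rgr_sum S).
have E i : component (rgr_sum S)
     (component (rgr_sum S) x i * \sum_(j <- t) component (rgr_sum S) y j) 0%N =
   if i == 0%N then component (rgr_sum S) x 0%N * component (rgr_sum S) y 0%N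
   else 0.
  rewrite mulr_sumr component_big.
  have F j : component (rgr_sum S)
      (component (rgr_sum S) x i * component (rgr_sum S) y j) 0%N =
      if (i == 0%N) && (j == 0%N) then
        component (rgr_sum S) x 0%N * component (rgr_sum S) y 0%N else 0.
    rewrite (component_hom (rgr_sum S) (i := (i + j)%N)); last exact: rgrM.
    by case: i j => [|i] [|j].
  rewrite (eq_bigr _ (fun j _ => F j)); case: eqP => _ /=; last by rewrite big1.
  case: (boolP (0%N \in t)) => t0; last first.
    by rewrite (zt _ t0) mulr0 big1 // => j _; case: ifP.
  by rewrite (bigD1_seq 0%N) //= big1 ?addr0 // => j /negbTE ->.
rewrite (eq_bigr _ (fun i _ => E i)).
case: (boolP (0%N \in r)) => r0; last first.
  by rewrite (zr _ r0) mul0r big1 // => i _; case: ifP.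
by rewrite (bigD1_seq 0%N) //= big1 ?addr0 // => j /negbTE ->.
Qed.

Record gsubmod (S : gring) (V : gmod S) := GSubmod {
  gsub_pred :> submodClosed V;
  gsub_comp : forall (v : V) n, v \in gsub_pred -> mcomp v n \in gsub_pred }.

Section SubModule.
Variables (R : pzRingType) (V : lmodType R) (Z : submodClosed V).
Definition sub_mod := {x : V | x \in Z}.
HB.instance Definition _ := SubChoice.on sub_mod.
HB.instance Definition _ := [SubChoice_isSubLmodule of sub_mod by <:].
End SubModule.

Section QuotientModule.
Variables (R : pzRingType) (V : lmodType R) (B : submodClosed V).

(* [submodClosed] does not coerce to the [zmodClosed] needed by [Quotient.quot]. *)
Definition quotient_pred (x : V) : bool := x \in B.
Fact quotient_pred_closed : zmod_closed quotient_pred.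
Proof.
split; first exact: rpred0.
move=> x y Bx By; suff: (x - y) \in B by [].
by apply: rpredD => //; rewrite -scaleN1r; apply: rpredZ.
Qed.
HB.instance Definition _ :=
  GRing.isZmodClosed.Build V quotient_pred quotient_pred_closed.

Definition quot_mod :=
  Quotient.quot (GRing.ZmodClosed.clone V quotient_pred _).
HB.instance Definition _ := GRing.Zmodule.on quot_mod.
HB.instance Definition _ := EqQuotient.on quot_mod.
HB.instance Definition _ := ZmodQuotient.on quot_mod.

Lemma pi_eq (x y : V) : \pi_quot_mod x = \pi_quot_mod y <-> x - y \in B.
Proof.
by split=> [/eqP|h]; [|apply/eqP]; rewrite -Quotient.idealrBE.
Qed.

Lemma pi_surj (x : quot_mod) : exists v, x = \pi_quot_mod v.
Proof. by exists (repr x); rewrite reprK. Qed.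

Lemma pi_add (x y : V) :
  \pi_quot_mod (x + y) = \pi_quot_mod x + \pi_quot_mod y.
Proof. exact: raddfD. Qed.

Lemma pi_eq0 (x : V) : \pi_quot_mod x = 0 <-> x \in B.
Proof. by rewrite -(raddf0 (\pi_quot_mod)) pi_eq subr0. Qed.

Definition quotient_scale (c : R) (x : quot_mod) : quot_mod :=
  \pi_quot_mod (c *: repr x).

Lemma pi_scale c x : quotient_scale c (\pi_quot_mod x) = \pi_quot_mod (c *: x).
Proof.
apply/pi_eq; rewrite -scalerBr; apply: rpredZ.
by apply/pi_eq; rewrite reprK.
Qed.

Fact quotient_scaleA a b x :
  quotient_scale a (quotient_scale b x) = quotient_scale (a * b) x.
Proof. have [v ->] := pi_surj x; by rewrite !pi_scale scalerA. Qed.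
Fact quotient_scale1 : left_id 1 quotient_scale.
Proof. by move=> x; have [v ->] := pi_surj x; rewrite pi_scale scale1r. Qed.
Fact quotient_scaleDr : right_distributive quotient_scale +%R.
Proof.
move=> c x y; have [v ->] := pi_surj x; have [w ->] := pi_surj y.
by rewrite -pi_add !pi_scale scalerDr pi_add.
Qed.
Fact quotient_scaleDl x :
  {morph quotient_scale^~ x : a b / a + b}.
Proof. by move=> a b; have [v ->] := pi_surj x; rewrite !pi_scale scalerDl pi_add. Qed.
HB.instance Definition _ := GRing.Zmodule_isLmodule.Build R quot_mod
  quotient_scaleA quotient_scale1 quotient_scaleDr quotient_scaleDl.

End QuotientModule.

Lemma direct_sum_intro (I : eqType) (V : zmodType) (G : I -> set V) :
  (forall i, G i 0) -> (forall i x y, G i x -> G i y -> G i (x - y)) ->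
  (forall v, exists w, decomposes G v w) ->
  (forall w, decomposes G 0 w -> forall i, w i = 0) -> direct_sum G.
Proof.
move=> G0 GB ex indep; split=> // v; have [w [Gw sw]] := ex v.
exists w; split=> // w' [Gw' sw']; apply: funext => i; apply/eqP.
rewrite -subr_eq0; apply/eqP; apply: (indep (fun i => w i - w' i)).
split; first by move=> j; apply: GB.
by rewrite -(subrr v); apply: fin_sumB.
Qed.

Section InducedGradings.
Variables (S : gring) (V : gmod S) (B : gsubmod V).

Definition sub_gr (n : int) : set (sub_mod B) := fun z => gr n (val z).

Lemma sub_gr_sum : direct_sum sub_gr.
Proof.
apply: direct_sum_intro => [i|i x y|z|w].
- by rewrite /sub_gr raddf0; exact: (direct_sum0 (gr_sum V)).
- by rewrite /sub_gr raddfB; exact: (direct_sumB (gr_sum V)).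
- exists (fun n => Sub (mcomp (val z) n) (gsub_comp n (valP z)) : sub_mod B).
  split=> [n|]; first exact: component_in.
  have [s [us zs ez]] := component_sum (gr_sum V) (val z).
  exists s; split=> // [n ns|]; first by apply: val_inj; rewrite /= /mcomp zs ?raddf0.
  by apply: val_inj; rewrite raddf_sum /= {1}ez.
- move=> [Gw [s [us zs e]]] i; apply: val_inj.
  suff H : component (gr_sum V) 0 = (fun n => val (w n)).
    by rewrite -[LHS]/((fun n => val (w n)) i) -H component0 raddf0.
  apply: component_uniq; split=> //.
  exists s; split=> // [n /zs ->|]; first exact: raddf0.
  by rewrite -raddf_sum -e raddf0.
Qed.

Lemma sub_grZ m n (s : S) (z : sub_mod B) :
  rgr m s -> sub_gr n z -> sub_gr (m%:Z + n) (s *: z).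
Proof. by rewrite /sub_gr linearZ; exact: grZ. Qed.

Definition sub_gmod : gmod S := GradedMod sub_gr_sum sub_grZ.

Definition quotient_gr (n : int) : set (quot_mod B) :=
  fun q => exists2 v : V, gr n v & q = \pi_(quot_mod B) v.

Lemma quotient_gr_sum : direct_sum quotient_gr.
Proof.
have pi_sum (s : seq int) (f : int -> V) :
    \pi_(quot_mod B) (\sum_(i <- s) f i) = \sum_(i <- s) \pi_(quot_mod B) (f i).
  elim: s => [|n s ih]; first by rewrite !big_nil; apply/pi_eq0/rpred0.
  by rewrite !big_cons pi_add ih.
have pi0 : \pi_(quot_mod B) 0 = 0 by apply/pi_eq0/rpred0.
apply: direct_sum_intro => [i|i x y [v gv ->] [w gw ->]|q|w [Gw [s [us zs e]]] i].
- by exists 0 => //; apply: (direct_sum0 (gr_sum V)).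
- exists (v - w); first exact: (direct_sumB (gr_sum V)).
  apply/eqP; rewrite subr_eq; apply/eqP.
  by rewrite -pi_add subrK.
- have [v ->] := pi_surj q; exists (fun n => \pi_(quot_mod B) (mcomp v n)); split.
    by move=> n; exists (mcomp v n) => //; apply: component_in.
  have [s [us zs ez]] := component_sum (gr_sum V) v.
  exists s; split=> // [n ns|]; first by rewrite /mcomp zs.
  by rewrite {1}ez pi_sum.
- pose f n : V := if n \in s then s2val (cid2 (Gw n)) else 0.
  have fG n : gr n (f n).
    rewrite /f; case: ifP => _; last exact: (direct_sum0 (gr_sum V)).
    by case: cid2.
  have fw n : w n = \pi_(quot_mod B) (f n).
    rewrite /f; case: ifPn => [_|/zs ->]; last by rewrite pi0.
    by case: cid2.
  have fB : \sum_(n <- s) f n \in (B : submodClosed V).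
    by apply/pi_eq0; rewrite pi_sum [RHS]e; apply: eq_bigr => n _; rewrite fw.
  rewrite fw; apply/pi_eq0; have := gsub_comp i fB.
  rewrite /mcomp (@component_uniq _ _ _ (gr_sum V) _ f) //.
  split=> //; exists s; split=> // n; rewrite /f; case: ifP => //.
Qed.

Lemma quotient_grZ m n (s : S) (q : quot_mod B) :
  rgr m s -> quotient_gr n q -> quotient_gr (m%:Z + n) (s *: q).
Proof.
move=> ms [v gv ->]; exists (s *: v); first exact: grZ.
exact: pi_scale.
Qed.

Definition quotient_gmod : gmod S := GradedMod quotient_gr_sum quotient_grZ.

End InducedGradings.

Definition noetherian (R : comNzRingType) : Prop :=
  forall I : submodClosed R^o, exists n (g : 'I_n -> R),
    (forall i, g i \in I) /\
    (forall x, x \in I -> exists c : 'I_n -> R, x = \sum_i c i * g i).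

Definition unit0 (S : gring) (x : S) : Prop :=
  rgr 0%N x /\ exists2 y : S, rgr 0%N y & x * y = 1.

Record glring := GLRing {
  glring_sort :> gring;
  glring_noetherian : noetherian glring_sort;
  glring_local : forall x y : glring_sort, rgr 0%N x -> rgr 0%N y ->
    ~ unit0 x -> ~ unit0 y -> ~ unit0 (x + y) }.

(* The homogeneous maximal ideal m_0 + S_1 + S_2 + ..., where m_0 is the
   maximal ideal of the degree 0 component. *)
Definition maxid (S : glring) (x : S) : bool := `[< ~ unit0 (rcomp x 0%N) >].

Section Residue.
Variable S : glring.

Lemma rcompP (x : S) n : rgr n (rcomp x n).
Proof. exact: component_in. Qed.

Lemma rcomp_id (x : S) : rgr 0%N x -> rcomp x 0 = x.
Proof. by move=> x0; rewrite /rcomp (component_hom (rgr_sum S) _ x0). Qed.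

Fact maxid_idealr : idealr_closed (@maxid S).
Proof.
split.
- apply/asboolP; rewrite /rcomp component0 => -[_ [y _]] /eqP.
  by rewrite mul0r eq_sym oner_eq0.
- apply/negP => /asboolP; apply; rewrite rcomp_id; last exact: rgr1.
  by split; [|exists 1; rewrite ?mulr1 //]; exact: rgr1.
move=> a u v /asboolP mu /asboolP mv; apply/asboolP.
rewrite /rcomp componentD; apply: glring_local => //.
- exact: rcompP.
- exact: rcompP.
rewrite -/(rcomp _ _) rcomp0M => -[_ [y y0 e]]; apply: mu; split.
  exact: rcompP.
exists (rcomp a 0 * y).
  by apply: (rgrM (m := 0%N) (n := 0%N)) => //; exact: rcompP.
by rewrite mulrA (mulrC _ (rcomp a 0)).
Qed.
HB.instance Definition _ := isIdealr.Build S (@maxid S) maxid_idealr.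

Definition maxid_ideal : idealr S := Idealr.clone S (@maxid S) _.

Definition resfield := {ideal_quot maxid_ideal}.
HB.instance Definition _ := GRing.ComNzRing.on resfield.
HB.instance Definition _ := EqQuotient.on resfield.

Lemma res_eq (x y : S) :
  \pi_resfield x = \pi_resfield y <-> x - y \in maxid_ideal.
Proof.
by split=> [/eqP|h]; [|apply/eqP]; rewrite -Quotient.idealrBE.
Qed.

Fact resfield_inv_ex (x : resfield) :
  exists y, if x == 0 then y == 0 else y * x == 1.
Proof.
case: eqP => [_|]; first by exists 0.
rewrite -[x]reprK -(pi_zeror (s := resfield)); set s := repr x => s0.
have : ~~ maxid s by apply/negP => ms; apply: s0; apply/res_eq; rewrite subr0.
rewrite /maxid asbool_neg negbK => /asboolP [_ [t t0 st1]].
exists (\pi t); apply/eqP.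
rewrite -(pi_oner (s := resfield)) -pi_mulr; apply/res_eq.
rewrite mulrC.
rewrite /in_mem /=; apply/asboolP.
rewrite /rcomp componentB -!/(rcomp _ _) rcomp0M (rcomp_id (rgr1 S)).
by rewrite (rcomp_id t0) st1 subrr => -[_ [y _]] /eqP; rewrite mul0r eq_sym oner_eq0.
Qed.

Definition resfield_inv (x : resfield) : resfield :=
  sval (cid (resfield_inv_ex x)).
Fact resfield_mulVf x : x != 0 -> resfield_inv x * x = 1.
Proof.
by rewrite /resfield_inv; case: cid => y /=; case: eqP => // _ /eqP.
Qed.
Fact resfield_inv0 : resfield_inv 0 = 0.
Proof. by rewrite /resfield_inv; case: cid => y /=; rewrite eqxx => /eqP. Qed.
HB.instance Definition _ :=
  GRing.ComNzRing_isField.Build resfield resfield_mulVf resfield_inv0.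

(* A k-vector space graded by [int] is a module over this graded ring. *)
Definition res_gr (n : nat) : set resfield :=
  fun x => if n is 0%N then True else x = 0.

Fact res_gr_sum : direct_sum res_gr.
Proof.
apply: direct_sum_intro => [[|n]|[|n]|v|w [Gw [s [us zs e]]]] //.
- by move=> x y -> ->; rewrite /res_gr subr0.
- exists (fun n => if n == 0%N then v else 0); split; first by case.
  by exists [:: 0%N]; split=> // [n|]; rewrite ?big_seq1 // inE => /negbTE ->.
- case=> [|n]; last exact: (Gw n.+1).
  case: (boolP (0%N \in s)) => [s0|/zs //].
  rewrite [RHS]e (bigD1_seq 0%N) //= big1 ?addr0 // => n.
  by case: n => // n _; exact: (Gw n.+1).
Qed.

Fact res_grM m n x y : res_gr m x -> res_gr n y -> res_gr (m + n)%N (x * y).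
Proof.
by case: m n => [|m] [|n] //= => [_ ->|-> _|-> _]; rewrite ?mulr0 ?mul0r.
Qed.

Definition res_gring : gring := GradedRing res_gr_sum (I : res_gr 0 1) res_grM.

End Residue.

Section BaseChange.
Variable S : glring.

Definition maxid_mul (V : lmodType S) (v : V) : bool :=
  `[< exists s : seq (S * V), (forall p, p \in s -> p.1 \in maxid_ideal S) /\
      v = \sum_(p <- s) p.1 *: p.2 >].

Fact maxid_mul_closed (V : lmodType S) : submod_closed (@maxid_mul V).
Proof.
split; first by apply/asboolP; exists [::]; rewrite big_nil.
move=> a u v /asboolP [s [ms ->]] /asboolP [t [mt ->]]; apply/asboolP.
exists ([seq (a * p.1, p.2) | p <- s] ++ t); split.
  move=> p; rewrite mem_cat => /orP [/mapP [q /ms mq ->]|/mt //].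
  exact: idealMr.
rewrite big_cat big_map scaler_sumr; congr (_ + _).
by apply: eq_bigr => p _; rewrite scalerA.
Qed.
HB.instance Definition _ (V : lmodType S) :=
  GRing.isSubmodClosed.Build S V (@maxid_mul V) (@maxid_mul_closed V).

Definition maxid_submod (V : lmodType S) : submodClosed V :=
  GRing.SubmodClosed.clone S V (@maxid_mul V) _.

(* The base change of V to the residue field, realized as V / mV with its
   action of the residue field S / m. *)
Definition residue (V : lmodType S) : Type := quot_mod (maxid_submod V).
HB.instance Definition _ (V : lmodType S) := GRing.Zmodule.on (residue V).

Section Action.
Variable V : lmodType S.

Definition residue_pi (v : V) : residue V := \pi_(quot_mod (maxid_submod V)) v.

Lemma residue_pi_eq0 v : residue_pi v = 0 <-> v \in maxid_submod V.
Proof. exact: pi_eq0. Qed.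

Lemma residue_pi_surj (x : residue V) : exists v, x = residue_pi v.
Proof. exact: pi_surj. Qed.

Lemma residue_piD v w : residue_pi (v + w) = residue_pi v + residue_pi w.
Proof. exact: pi_add. Qed.

Lemma residue_pi_eq v w :
  residue_pi v = residue_pi w <-> v - w \in maxid_submod V.
Proof. exact: pi_eq. Qed.

Definition residue_scale (c : resfield S) (x : residue V) : residue V :=
  residue_pi (repr c *: repr (x : quot_mod (maxid_submod V))).

Lemma residue_scaleE (s : S) (v : V) :
  residue_scale (\pi_(resfield S) s) (residue_pi v) = residue_pi (s *: v).
Proof.
apply/residue_pi_eq; set s' := repr _; set v' := repr _.
have -> : s' *: v' - s *: v = (s' - s) *: v' + s *: (v' - v).
  by rewrite scalerBl scalerBr addrA subrK.
apply: rpredD; last by apply: rpredZ; apply/residue_pi_eq; rewrite /residue_pi reprK.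
have ms : s' - s \in maxid_ideal S by apply/res_eq; rewrite reprK.
apply/asboolP; exists [:: (s' - s, v')]; rewrite big_seq1; split=> // p.
by rewrite inE => /eqP ->.
Qed.

Lemma res_surj (c : resfield S) : exists s, c = \pi_(resfield S) s.
Proof. by exists (repr c); rewrite reprK. Qed.

Fact residue_scaleA a b x :
  residue_scale a (residue_scale b x) = residue_scale (a * b) x.
Proof.
have [s ->] := res_surj a; have [t ->] := res_surj b.
have [v ->] := residue_pi_surj x.
by rewrite -pi_mulr !residue_scaleE scalerA.
Qed.
Fact residue_scale1 : left_id 1 residue_scale.
Proof.
move=> x; have [v ->] := residue_pi_surj x.
by rewrite -(pi_oner (s := resfield S)) residue_scaleE scale1r.
Qed.
Fact residue_scaleDr : right_distributive residue_scale +%R.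
Proof.
move=> c x y; have [s ->] := res_surj c.
have [v ->] := residue_pi_surj x; have [w ->] := residue_pi_surj y.
by rewrite -residue_piD !residue_scaleE scalerDr residue_piD.
Qed.
Fact residue_scaleDl x : {morph residue_scale^~ x : a b / a + b}.
Proof.
move=> a b; have [s ->] := res_surj a; have [t ->] := res_surj b.
have [v ->] := residue_pi_surj x.
by rewrite -pi_addr !residue_scaleE scalerDl residue_piD.
Qed.
HB.instance Definition _ := GRing.Zmodule_isLmodule.Build (resfield S) (residue V)
  residue_scaleA residue_scale1 residue_scaleDr residue_scaleDl.

Lemma residue_piZ (s : S) v :
  residue_pi (s *: v) = \pi_(resfield S) s *: residue_pi v.
Proof. exact: (esym (residue_scaleE s v)). Qed.

End Action.

Section LinearMap.
Variables (V W : lmodType S) (f : {linear V -> W}).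

Definition residue_map (x : residue V) : residue W :=
  residue_pi (f (repr (x : quot_mod (maxid_submod V)))).

Lemma residue_mapE v : residue_map (residue_pi v) = residue_pi (f v).
Proof.
apply/residue_pi_eq; rewrite -linearB.
have : repr (residue_pi v : quot_mod (maxid_submod V)) - v \in maxid_submod V.
  by apply/residue_pi_eq; rewrite /residue_pi reprK.
move: (_ - v) => u /asboolP [s [ms ->]]; apply/asboolP.
exists [seq (p.1, f p.2) | p <- s]; split.
  by move=> p /mapP [q /ms mq ->].
by rewrite big_map linear_sum; apply: eq_bigr => p _; rewrite linearZ.
Qed.

Fact residue_map_linear : linear residue_map.
Proof.
move=> c x y; have [s ->] := res_surj c.
have [v ->] := residue_pi_surj x; have [w ->] := residue_pi_surj y.
rewrite -residue_piZ -residue_piD !residue_mapE linearP.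
by rewrite residue_piD residue_piZ.
Qed.
HB.instance Definition _ :=
  GRing.isLinear.Build (resfield S) (residue V) (residue W) _ residue_map
    residue_map_linear.

End LinearMap.

Section GradedBaseChange.
Variable V : gmod S.

Fact maxid_homogeneous (s : S) p :
  s \in maxid_ideal S -> rcomp s p \in maxid_ideal S.
Proof.
move=> /asboolP ms; apply/asboolP; case: p => [|p].
  by rewrite rcomp_id //; exact: rcompP.
rewrite /rcomp (component_hom _ _ (rcompP s p.+1)) => -[_ [y _]] /eqP.
by rewrite mul0r eq_sym oner_eq0.
Qed.

Fact maxid_submod_comp (v : V) n :
  v \in maxid_submod V -> mcomp v n \in maxid_submod V.
Proof.
move=> /asboolP [s [ms ->]]; rewrite /mcomp component_big big_seq.
apply: rpred_sum => -[a w] /ms /= ma.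
have [r [_ _ {1}->]] := component_sum (rgr_sum S) a.
rewrite scaler_suml component_big; apply: rpred_sum => p _.
have := mcompZ w n (rcompP a p); rewrite {1}/mcomp {1}/rcomp => ->.
apply/asboolP; exists [:: (rcomp a p, mcomp w (n - p%:Z))].
rewrite big_seq1; split=> // q; rewrite inE => /eqP -> /=.
exact: maxid_homogeneous.
Qed.

Definition maxid_gsubmod : gsubmod V := GSubmod maxid_submod_comp.

Definition residue_gr (n : int) : set (residue V) :=
  fun x => exists2 v : V, gr n v & x = residue_pi v.

Fact residue_gr_sum : direct_sum residue_gr.
Proof. exact: (quotient_gr_sum maxid_gsubmod). Qed.

Fact residue_grZ m n (c : resfield S) (x : residue V) :
  res_gr m c -> residue_gr n x -> residue_gr (m%:Z + n) (c *: x).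
Proof.
case: m => [_|m ->] [v gv ->]; last first.
  by rewrite scale0r; exact: (direct_sum0 residue_gr_sum).
have [s ->] := res_surj c; exists (rcomp s 0 *: v).
  exact: (grZ (m := 0%N) (rcompP s 0) gv).
rewrite residue_piZ; congr (_ *: _); apply/res_eq/asboolP.
rewrite /rcomp componentB -!/(rcomp _ _) (rcomp_id (rcompP s 0)) subrr.
by move=> -[_ [y _]] /eqP; rewrite mul0r eq_sym oner_eq0.
Qed.

Definition residue_gmod : gmod (res_gring S) :=
  @GradedMod (res_gring S) (residue V) residue_gr residue_gr_sum residue_grZ.

End GradedBaseChange.
End BaseChange.

Record ghom (S : gring) (V W : gmod S) := GHom {
  ghom_fun :> {linear V -> W};
  ghom_deg : forall n v, gr n v -> gr n (ghom_fun v) }.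

(* The differential is a graded map D -> D(a), where D(a)_n = D_(n + a). *)
Record dmod (S : gring) (a : int) := DMod {
  dmod_gmod :> gmod S;
  dd : {linear dmod_gmod -> dmod_gmod};
  dd_deg : forall n v, gr n v -> gr (n + a) (dd v);
  ddK : forall v, dd (dd v) = 0 }.
Arguments dd {S a d}.

Record dhom (S : gring) (a : int) (D E : dmod S a) := DHom {
  dhom_fun :> ghom D E;
  dhom_dd : forall v, dhom_fun (dd v) = dd (dhom_fun v) }.

Section Homology.
Variables (S : gring) (a : int) (D : dmod S a).

Lemma mcomp_dd (v : D) n : mcomp (dd v) n = dd (mcomp v (n - a)).
Proof.
rewrite /mcomp (@component_uniq _ _ _ (gr_sum D) _
  (fun k => dd (component (gr_sum D) v (k - a)))) //.
split=> [k|].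
  have := dd_deg (component_in (gr_sum D) v (k - a)).
  by rewrite subrK.
have [r [ur zr ev]] := component_sum (gr_sum D) v.
exists [seq i + a | i <- r]; split.
- by rewrite map_inj_uniq // => i j /addIr.
- move=> i /mapP ni /=; rewrite zr ?raddf0 //; apply/negP => ri; apply: ni.
  by exists (i - a); rewrite ?subrK.
- rewrite {1}ev big_map raddf_sum; apply: eq_bigr => i _.
  by rewrite addrK.
Qed.

Definition cycle_pred (v : D) : bool := dd v == 0.
Fact cycle_closed : submod_closed cycle_pred.
Proof.
split=> [|c u v /eqP u0 /eqP v0]; apply/eqP; first exact: raddf0.
by rewrite linearP u0 v0 scaler0 addr0.
Qed.
HB.instance Definition _ := GRing.isSubmodClosed.Build S D cycle_pred cycle_closed.
Definition cycle_submod : submodClosed D := GRing.SubmodClosed.clone S D cycle_pred _.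
Fact cycle_comp (v : D) n : v \in cycle_submod -> mcomp v n \in cycle_submod.
Proof.
move=> /eqP v0; apply/eqP; have := mcomp_dd v (n + a).
by rewrite addrK => <-; rewrite v0; exact: component0.
Qed.

Definition cycles : gmod S := sub_gmod (GSubmod cycle_comp).

Definition boundary_pred (z : cycles) : bool := `[< exists v : D, dd v = val z >].
Fact boundary_closed : submod_closed boundary_pred.
Proof.
split=> [|c u v /asboolP [x ex] /asboolP [y ey]]; apply/asboolP.
  by exists 0; rewrite !raddf0.
by exists (c *: x + y); rewrite linearP ex ey linearP.
Qed.
HB.instance Definition _ :=
  GRing.isSubmodClosed.Build S cycles boundary_pred boundary_closed.
Definition boundary_submod : submodClosed cycles :=
  GRing.SubmodClosed.clone S cycles boundary_pred _.

Lemma val_mcomp (z : cycles) n :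
  val (mcomp z n : sub_mod cycle_submod) = mcomp (val z : D) n.
Proof.
suff H : component (gr_sum D) (val z) = (fun n => val (mcomp z n : sub_mod _)).
  by rewrite /mcomp H.
apply: component_uniq; split=> [k|].
  exact: (component_in (gr_sum cycles) z k).
have [s [us zs ez]] := component_sum (gr_sum cycles) z.
exists s; split=> // [i /zs|]; last first.
  rewrite {1}ez; exact: (@raddf_sum (sub_mod cycle_submod) D val).
by rewrite /mcomp => ->; rewrite raddf0.
Qed.

Fact boundary_comp (z : cycles) n :
  z \in boundary_submod -> mcomp z n \in boundary_submod.
Proof.
move=> /asboolP [v ev]; apply/asboolP; exists (mcomp v (n - a)).
by rewrite val_mcomp -mcomp_dd ev.
Qed.

Definition homology : gmod S := quotient_gmod (GSubmod boundary_comp).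

Definition homology_class (z : cycles) : homology :=
  \pi_(quot_mod boundary_submod) z.

Definition cycle_repr (x : homology) : cycles :=
  repr (x : quot_mod boundary_submod).

End Homology.

Section HomologyMap.
Variables (S : gring) (a : int) (D E : dmod S a) (f : dhom D E).

Fact cycle_map_subproof (z : cycles D) : f (val z) \in cycle_submod E.
Proof. by apply/eqP; rewrite -dhom_dd (eqP (valP z)) raddf0. Qed.

Definition cycle_map (z : cycles D) : cycles E :=
  (Sub (f (val z)) (cycle_map_subproof z) : sub_mod (cycle_submod E)).

Definition homology_map (x : homology D) : homology E :=
  homology_class (cycle_map (cycle_repr x)).

Lemma homology_mapE (z : cycles D) :
  homology_map (homology_class z) = homology_class (cycle_map z).
Proof.
apply/pi_eq/asboolP.
have : cycle_repr (homology_class z) - z \in boundary_submod D.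
  by apply/pi_eq; rewrite /cycle_repr reprK.
move=> /asboolP [v ev]; exists (f v).
by rewrite -dhom_dd ev !raddfB.
Qed.

End HomologyMap.

Definition quasi_iso (S : gring) (a : int) (D E : dmod S a) (f : dhom D E) : Prop :=
  bijective (homology_map f).

Definition gmod_isom (S : gring) (V W : gmod S) : Prop :=
  exists f : ghom V W, bijective f.

Section ZeroDmod.
Variables (S : gring) (a : int) (V : gmod S).
Fact zero_dd_deg n (v : V) : gr n v -> gr (n + a) ((\0 : {linear V -> V}) v).
Proof. by move=> _; exact: (direct_sum0 (gr_sum V)). Qed.
Definition zero_dmod : dmod S a :=
  @DMod S a V (\0 : {linear V -> V}) zero_dd_deg (fun=> erefl).
End ZeroDmod.

Section ResidueDmod.
Variables (S : glring) (a : int) (D : dmod S a).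

Definition residue_dd : {linear residue_gmod D -> residue_gmod D} :=
  residue_map (@dd _ _ D).

Fact residue_dd_deg n (x : residue_gmod D) : gr n x -> gr (n + a) (residue_dd x).
Proof.
move=> [v gv ->]; exists (dd v); first exact: dd_deg.
exact: residue_mapE.
Qed.

Fact residue_ddK (x : residue_gmod D) : residue_dd (residue_dd x) = 0.
Proof.
have [v ->] := residue_pi_surj x.
rewrite /residue_dd /= !residue_mapE ddK; apply/residue_pi_eq0; exact: rpred0.
Qed.

Definition residue_dmod : dmod (res_gring S) a := DMod residue_dd_deg residue_ddK.

End ResidueDmod.

Definition fin_gen (R : pzRingType) (V : lmodType R) : Prop :=
  exists n (e : 'I_n -> V),
    forall v, exists c : 'I_n -> R, v = \sum_i c i *: e i.

Definition is_basis (R : pzRingType) (V : lmodType R) (U : set V) (n : nat)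
    (e : 'I_n -> V) : Prop :=
  (forall i, U (e i)) /\
  (forall v, U v -> exists! c : {ffun 'I_n -> R}, v = \sum_i c i *: e i).

(* A homogeneous basis with degrees deg amounts to a graded isomorphism with
   the direct sum of the S(- deg l). *)
Definition homogeneous_basis (S : gring) (V : gmod S) (U : set V) (n : nat)
    (e : 'I_n -> V) (deg : 'I_n -> int) : Prop :=
  is_basis U e /\ (forall l, gr (deg l) (e l)).

Definition graded_free (S : gring) (V : gmod S) (U : set V) : Prop :=
  exists n (e : 'I_n -> V) (deg : 'I_n -> int), homogeneous_basis U e deg.

Definition gsub_set (S : gring) (V : gmod S) (P : gsubmod V) : set V :=
  fun v => v \in gsub_pred P.

Definition free_flag (S : gring) (a : int) (G : dmod S a) : Prop :=
  exists P : int -> gsubmod G,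
    [/\ direct_sum (fun i => gsub_set (P i)),
        forall i, graded_free (gsub_set (P i)),
        forall i v, i < 0 -> gsub_set (P i) v -> v = 0
      & forall i v, gsub_set (P i) v ->
          exists w : int -> G,
            decomposes (fun j => gsub_set (P j)) (dd v) w /\
            (forall j, i <= j -> w j = 0)].

Definition minimal (S : glring) (a : int) (F : dmod S a) : Prop :=
  forall x : residue_dmod F, dd x = 0.

(* All modules are finitely generated; for F this is part of [graded_free]. *)
Definition minimal_free_resolution (S : glring) (a : int) (F D : dmod S a)
    (f : dhom F D) : Prop :=
  [/\ quasi_iso f, graded_free [set: F], minimal F
    & exists (G : dmod S a) (i : dhom F G) (r : dhom G F) (q : dhom G D),
        [/\ fin_gen G, free_flag G, forall x, r (i x) = x, quasi_iso q
          & forall x, f x = q (i x)]].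

Definition has_betti (S : glring) (a : int) (D : dmod S a) (j : int) (b : nat) :
    Prop :=
  exists (F : dmod S a) (f : dhom F D), minimal_free_resolution f /\
    exists e : 'I_b -> homology (residue_dmod F), is_basis (gr j) e.

Definition has_total_betti (S : glring) (a : int) (D : dmod S a) (b : nat) :
    Prop :=
  exists beta : int -> nat,
    (forall j, has_betti D j (beta j)) /\ fin_sum beta b.

Definition betti_deficient (S : glring) (a : int) (D : dmod S a) : Prop :=
  exists b b' : nat,
    [/\ has_total_betti D b, has_total_betti (zero_dmod a (homology D)) b'
      & (b < b')%N].

Definition projective (R : pzRingType) (P : lmodType R) : Prop :=
  forall (A B : lmodType R) (g : {linear A -> B}) (f : {linear P -> B}),
    (forall b, exists x, g x = b) ->
    exists h : {linear P -> A}, forall p, g (h p) = f p.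

Definition resolves (R : pzRingType) (M : lmodType R) (F : nat -> lmodType R)
    (d : forall i, {linear F i.+1 -> F i}) (aug : {linear F 0%N -> M}) : Prop :=
  [/\ forall m, exists x, aug x = m,
      forall x, aug x = 0 <-> exists y, d 0%N y = x
    & forall i x, d i x = 0 <-> exists y, d i.+1 y = x].

Definition finite_proj_dim (R : pzRingType) (M : lmodType R) : Prop :=
  exists (P : nat -> lmodType R) (d : forall i, {linear P i.+1 -> P i})
      (aug : {linear P 0%N -> M}) (n : nat),
    [/\ forall i, projective (P i), resolves d aug
      & forall i (x : P i), (n < i)%N -> x = 0].

(* B i k is the number of summands S(-k) in the i-th module of a minimal
   graded free resolution of M. *)
Definition graded_betti (S : glring) (M : gmod S) (B : nat -> int -> nat) :
    Prop :=
  exists (F : nat -> gmod S) (d : forall i, ghom (F i.+1) (F i))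
      (aug : ghom (F 0%N) M),
    [/\ resolves (F := fun i => F i : lmodType S) (fun i => ghom_fun (d i)) aug,
        forall i (x : residue (F i.+1)), residue_map (d i) x = 0
      & forall i, exists n (e : 'I_n -> F i) (deg : 'I_n -> int),
          homogeneous_basis [set: F i] e deg /\
          forall k, B i k = #|[set l | deg l == k]%SET|].

Definition betti_table (B : nat -> int -> nat) (column : nat) (row : int) : nat :=
  B column (row + column%:Z).

(* Rows are numbered from top to bottom, whence the sign. *)
Definition line_slope (column : nat) (row : int) (column' : nat) (row' : int) : rat :=
  - ((row' - row)%:~R / (column'%:Z - column%:Z)%:~R).

(* Main.v *)
From HB Require Import structures.
Require Import Defs.
From mathcomp Require Import all_boot all_order all_algebra.
From mathcomp Require Import boolp classical_sets.
From mathcomp Require Import zify ring.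

(** Let [F] be the minimal graded free resolution of [M = H(D)]; it is finite
because [M] has finite projective dimension. Put a generator of [F_i] of
degree [k] in degree [k - i * a] of [G = \bigoplus_i F_i]. Level by level one
perturbs the differential of [F] to a square-zero endomorphism of degree [a] of
[G], which equals the differential of [F] plus terms lowering [i] by at least
[2], together with a quasi-isomorphism from [G] to [D]. If [G] is not minimal,
then one of the extra terms has a unit entry, from a generator of degree [k] in
[F_i] to one of degree [k'] in [F_(i - j)]; comparing degrees,
[k - k' = (j - 1) * a], which says that the corresponding entries of the Betti
table lie on a line of slope [1 - a + a / j]. Otherwise [G] with this
differential is a minimal free resolution of [D], and for the same reason [G]
with a possibly different differential is one of [H(D)]. Minimal free
resolutions being unique up to homotopy, [D] and [H(D)] have the same Betti
numbers. *)

Set Implicit Arguments.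
Unset Strict Implicit.
Unset Printing Implicit Defensive.
Import GRing.Theory Num.Theory Order.TTheory.
Local Open Scope ring_scope.

(** * Integer gradings and graded free modules *)

(** The grading of [S] extended by zero to negative degrees: coordinates of homogeneous vectors live
    in degrees [n - deg x], which may be negative. *)
Definition hgr (S : gring) (n : int) (s : S) : Prop :=
  if n is Posz m then rgr m s else s = 0.

Lemma hgr_sum (S : gring) : direct_sum (@hgr S).
Proof.
apply: direct_sum_intro => [[m|m]|[m|m] x y|v|w [Gw [s [us zs e]]] [m|m]] //=.
- exact: (direct_sum0 (rgr_sum S)).
- exact: (direct_sumB (rgr_sum S)).
- by move=> -> ->; rewrite subrr.
- exists (fun n => if n is Posz m then rcomp v m else 0); split.
    by case=> //= m; exact: component_in.
  have [s [us zs ev]] := component_sum (rgr_sum S) v.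
  exists [seq Posz m | m <- s]; split; last by rewrite big_map.
    by rewrite map_inj_uniq // => i j [].
  by case=> // m; rewrite mem_map; [exact: zs|move=> i j []].
- suff H : component (rgr_sum S) 0 = (fun m => w (Posz m)).
    by rewrite -[LHS]/((fun m => w (Posz m)) m) -H component0.
  apply: component_uniq; split=> [k|]; first exact: (Gw (Posz k)).
  exists (undup [seq absz i | i <- s]).
  have zs' k : k \notin undup [seq absz i | i <- s] -> w (Posz k) = 0.
    rewrite mem_undup => /mapP nk; apply: zs; apply/negP => ks; apply: nk.
    by exists (Posz k).
  split=> //; first exact: undup_uniq.
  rewrite [LHS]e -(big_map Posz xpredT w); apply: fin_sum_eq => //.
    by rewrite map_inj_uniq ?undup_uniq // => i j [].
  case=> k; last by move=> _; exact: (Gw (Negz k)).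
  by rewrite mem_map; [exact: zs'|move=> i j []].
- exact: (Gw (Negz m)).
Qed.

Lemma hgrZ (S : gring) (V : gmod S) m n (s : S) (v : V) :
  hgr m s -> gr n v -> gr (m + n) (s *: v).
Proof.
case: m => m /=; first exact: grZ.
by move=> -> _; rewrite scale0r; exact: (direct_sum0 (gr_sum V)).
Qed.

Section Graded.
Variable S : gring.
Implicit Types V W : gmod S.

Lemma gr0 V n : gr n (0 : V).
Proof. exact: (direct_sum0 (gr_sum V)). Qed.

Lemma grB V n (u v : V) : gr n u -> gr n v -> gr n (u - v).
Proof. exact: (direct_sumB (gr_sum V)). Qed.

Lemma grN V n (v : V) : gr n v -> gr n (- v).
Proof. by rewrite -sub0r; apply: grB; exact: gr0. Qed.

Lemma grD V n (u v : V) : gr n u -> gr n v -> gr n (u + v).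
Proof. by move=> gu gv; rewrite -[v]opprK; apply/grB/grN. Qed.

Lemma gr_bigsum V n (J : Type) (r : seq J) (P : pred J) (f : J -> V) :
  (forall j, P j -> gr n (f j)) -> gr n (\sum_(j <- r | P j) f j).
Proof. by move=> gf; elim/big_ind: _ => //; [exact: gr0|exact: grD]. Qed.

Lemma mcomp_in V (v : V) n : gr n (mcomp v n).
Proof. exact: component_in. Qed.

Lemma mcomp_id V (v : V) n : gr n v -> mcomp v n = v.
Proof. by move=> gv; rewrite /mcomp (component_hom _ _ gv) eqxx. Qed.

Definition homdeg V W (k : int) (f : V -> W) : Prop :=
  forall n v, gr n v -> gr (n + k) (f v).

Lemma mcomp_hom V W k (f : {linear V -> W}) (v : V) n :
  homdeg k f -> mcomp (f v) (n + k) = f (mcomp v n).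
Proof.
move=> hf; rewrite /mcomp (@component_uniq _ _ _ (gr_sum W) _
  (fun n => f (component (gr_sum V) v (n - k)))); first by rewrite addrK.
split=> [m|].
  by have := hf _ _ (component_in (gr_sum V) v (m - k)); rewrite subrK.
have [r [ur zr ev]] := component_sum (gr_sum V) v.
exists [seq i + k | i <- r]; split.
- by rewrite map_inj_uniq // => i j /addIr.
- move=> i /mapP ni /=; rewrite zr ?raddf0 //; apply/negP => ri; apply: ni.
  by exists (i - k); rewrite ?subrK.
- rewrite {1}ev big_map raddf_sum; apply: eq_bigr => i _.
  by rewrite addrK.
Qed.

End Graded.

Section GradedFree.
Variables (S : gring) (I : finType) (deg : I -> int).

(** The grading of the direct sum of the twists [S(- deg x)]. *)
Definition gfree_gr (n : int) : set {ffun I -> S^o} :=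
  fun v => forall x, hgr (n - deg x) (v x).

Lemma gfree_gr_sum : direct_sum gfree_gr.
Proof.
apply: direct_sum_intro => [n x|n u v gu gv x|v|w [Gw [s [us zs e]]] n].
- by rewrite ffunE; exact: (direct_sum0 (hgr_sum S)).
- by rewrite !ffunE; apply: (direct_sumB (hgr_sum S)).
- exists (fun n => [ffun x => component (hgr_sum S) (v x) (n - deg x)]).
  split=> [n x|]; first by rewrite ffunE; exact: component_in.
  have /choice [s sP] x := component_sum (hgr_sum S) (v x).
  (* One finite set of degrees has to serve all coordinates, so their shifted supports are collected
     in [t]. *)
  pose t := undup (flatten [seq [seq i + deg x | i <- s x] | x <- enum I]).
  have zt n x : n \notin t -> component (hgr_sum S) (v x) (n - deg x) = 0.
    move=> nt; have [_ z _] := sP x; apply: z; apply: contraNN nt => ns.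
    rewrite mem_undup; apply/flattenP; exists [seq i + deg x | i <- s x].
      by apply: map_f; rewrite mem_enum.
    by apply/mapP; exists (n - deg x); rewrite ?subrK.
  exists t; split=> [|n nt|]; first exact: undup_uniq.
    by apply/ffunP => x; rewrite !ffunE zt.
  apply/ffunP => x; have [ux zx ex] := sP x; rewrite sum_ffunE.
  rewrite (eq_bigr (fun n => component (hgr_sum S) (v x) (n - deg x))); last first.
    by move=> n _; rewrite ffunE.
  rewrite [LHS]ex.
  rewrite (eq_bigr (fun i => component (hgr_sum S) (v x) (i + deg x - deg x)));
    last by move=> i _; rewrite addrK.
  rewrite -(big_map (+%R^~ (deg x)) xpredT
              (fun n => component (hgr_sum S) (v x) (n - deg x))).
  apply: fin_sum_eq => [| |n|n /zt ->] //.
  - by rewrite map_inj_uniq // => i j /addIr.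
  - exact: undup_uniq.
  - move=> /mapP nx; apply: zx; apply/negP => ns; apply: nx.
    by exists (n - deg x); rewrite ?subrK.
- apply/ffunP => x; rewrite ffunE.
  suff H : component (hgr_sum S) 0 = (fun m => w (m + deg x) x).
    have := congr1 (fun f => f (n - deg x)) H.
    by rewrite component0 subrK.
  apply: component_uniq; split=> [k|].
    by have := Gw (k + deg x) x; rewrite addrK.
  exists [seq i - deg x | i <- s]; split.
  - by rewrite map_inj_uniq // => i j /addIr.
  - move=> k /mapP nk; rewrite zs ?ffunE //; apply/negP => ks; apply: nk.
    by exists (k + deg x); rewrite ?addrK.
  - have := congr1 (fun f : {ffun I -> S^o} => f x) e.
    rewrite ffunE sum_ffunE big_map => e0; apply: (etrans e0); apply: eq_bigr => i _.
    by rewrite subrK.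
Qed.

Lemma gfree_grZ m n (s : S) (v : {ffun I -> S^o}) :
  rgr m s -> gfree_gr n v -> gfree_gr (m%:Z + n) (s *: v).
Proof.
move=> ms gv x; have := gv x; rewrite ffunE -addrA.
case: (n - deg x) => k /=; first exact: rgrM.
by move=> ->; rewrite scaler0; exact: (direct_sum0 (hgr_sum S)).
Qed.

Definition gfree : gmod S := GradedMod gfree_gr_sum gfree_grZ.

End GradedFree.

(** * Homogeneous bases and lifting from flags *)

(** The coordinates are carried as linear functionals, so that triangularity and minimality become
    conditions on [hco]. *)
Record hbasis (S : gring) (V : gmod S) (I : finType) := HBasis {
  hb_fun :> I -> V;
  hdeg : I -> int;
  hco : I -> {linear V -> S^o};
  hb_expand : forall v, v = \sum_x hco x v *: hb_fun x;
  hco_basis : forall x y, hco y (hb_fun x) = (x == y)%:R;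
  hb_gr : forall x, gr (hdeg x) (hb_fun x) }.

Section Bases.
Variables (S : gring) (V : gmod S) (I : finType) (B : hbasis V I).

Lemma hco_sum (c : I -> S) y : hco B y (\sum_x c x *: B x) = c y.
Proof.
rewrite linear_sum (bigD1 y) //= big1 ?addr0 => [|x /negbTE xy].
  by rewrite linearZ /= hco_basis eqxx; exact: mulr1.
by rewrite linearZ /= hco_basis xy; exact: mulr0.
Qed.

Lemma mcompZ_hom (s : S) (v : V) d n : gr d v ->
  mcomp (s *: v) n = component (hgr_sum S) s (n - d) *: v.
Proof.
move=> gv; have [r [ur zr es]] := component_sum (hgr_sum S) s.
rewrite {1}es scaler_suml /mcomp component_big.
have E i : component (gr_sum V) (component (hgr_sum S) s i *: v) n =
    if i == n - d then component (hgr_sum S) s (n - d) *: v else 0.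
  rewrite (component_hom (gr_sum V) (i := i + d)).
    by rewrite -subr_eq eq_sym; case: eqP => [->|].
  by apply: hgrZ => //; exact: component_in.
rewrite (eq_bigr _ (fun i _ => E i)).
case: (boolP (n - d \in r)) => rn; last first.
  rewrite (zr _ rn) scale0r big_seq big1 // => i ir.
  by case: eqP => // e; rewrite -e ir in rn.
by rewrite (bigD1_seq (n - d)) //= eqxx big1 ?addr0 // => j /negbTE ->.
Qed.

Lemma hco_mcomp (v : V) n x :
  hco B x (mcomp v n) = component (hgr_sum S) (hco B x v) (n - hdeg B x).
Proof.
have -> : mcomp v n = \sum_x component (hgr_sum S) (hco B x v) (n - hdeg B x) *: B x.
  rewrite {1}(hb_expand B v) /mcomp component_big.
  by apply: eq_bigr => y _; apply: mcompZ_hom; exact: hb_gr.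
exact: hco_sum.
Qed.

Lemma hco_gr n (v : V) x : gr n v -> hgr (n - hdeg B x) (hco B x v).
Proof. by move=> /mcomp_id <-; rewrite hco_mcomp; exact: component_in. Qed.

(** Agreement is required only on the basis elements that occur in [v], which is what an induction
    along levels provides. *)
Lemma hb_ext_at (W : lmodType S) (f g : {linear V -> W}) (v : V) :
  (forall x, hco B x v = 0 \/ f (B x) = g (B x)) -> f v = g v.
Proof.
move=> fg; rewrite (hb_expand B v) !linear_sum; apply: eq_bigr => x _.
by rewrite !linearZ /=; case: (fg x) => ->; rewrite ?scale0r.
Qed.

Lemma hb_ext (W : lmodType S) (f g : {linear V -> W}) :
  (forall x, f (B x) = g (B x)) -> f =1 g.
Proof. by move=> fg v; apply: hb_ext_at => x; right. Qed.

Variables (W : lmodType S) (t : I -> W).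

Definition hext_fun (v : V) : W := \sum_x hco B x v *: t x.

Fact hext_linear : linear hext_fun.
Proof.
move=> c u v; rewrite /hext_fun scaler_sumr -big_split; apply: eq_bigr => x _.
by rewrite linearP scalerDl scalerA.
Qed.
HB.instance Definition _ := GRing.isLinear.Build S V W _ hext_fun hext_linear.

Definition hext : {linear V -> W} := hext_fun.

Lemma hext_sum v : hext v = \sum_x hco B x v *: t x.
Proof. by []. Qed.

Lemma hextE x : hext (B x) = t x.
Proof.
rewrite hext_sum (bigD1 x) //= hco_basis eqxx scale1r big1 ?addr0 // => y.
by rewrite hco_basis eq_sym => /negbTE ->; rewrite scale0r.
Qed.

End Bases.
Arguments hext : simpl never.

Lemma hext_deg (S : gring) (V W : gmod S) (I : finType) (B : hbasis V I)
    (t : I -> W) k :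
  (forall x, gr (hdeg B x + k) (t x)) -> homdeg k (hext B t).
Proof.
move=> gt n v gv; rewrite hext_sum; apply: gr_bigsum => x _.
have -> : n + k = (n - hdeg B x) + (hdeg B x + k) by rewrite addrA subrK.
by apply: hgrZ => //; exact: hco_gr.
Qed.

Section QuasiIso.
Variables (S : gring) (a : int).
Implicit Types D E : dmod S a.

Definition cyc_fun D (z : cycles D) : D := val z.
Fact cyc_linear D : linear (@cyc_fun D).
Proof. by move=> c y z; exact: (@linearP S (sub_mod (cycle_submod D)) D _ val). Qed.
HB.instance Definition _ D :=
  GRing.isLinear.Build S (cycles D) D _ (@cyc_fun D) (@cyc_linear D).
Definition cyc D : {linear cycles D -> D} := @cyc_fun D.
Arguments cyc {D} : simpl never.

Lemma cycP D (v : D) : dd v = 0 -> exists z : cycles D, cyc z = v.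
Proof.
move=> v0; have vc : v \in cycle_submod D by apply/eqP.
by exists (Sub v vc : sub_mod (cycle_submod D)); exact: SubK.
Qed.

Lemma dd_cyc D (z : cycles D) : dd (cyc z) = 0.
Proof. exact/eqP/(valP z). Qed.

Lemma cyc_map D E (q : dhom E D) (z : cycles E) : cyc (Defs.cycle_map q z) = q (cyc z).
Proof. by []. Qed.

Lemma homology_class_eq D (y z : cycles D) :
  homology_class y = homology_class z <-> exists v, dd v = cyc y - cyc z.
Proof.
by rewrite -raddfB; split=> [/pi_eq/asboolP [v ev]|[v ev]];
  [|apply/pi_eq/asboolP]; exists v.
Qed.

Lemma homology_class_surj D (x : homology D) : exists z, x = homology_class z.
Proof. exact: pi_surj. Qed.

Variables (D E : dmod S a) (q : dhom E D).

(** The two clauses are injectivity and surjectivity on homology, put on elements so that lifting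
    arguments avoid quotients. *)
Lemma quasi_isoP : quasi_iso q <->
  (forall (z : E) (x : D), dd z = 0 -> q z = dd x -> exists y, dd y = z) /\
  (forall x : D, dd x = 0 -> exists (c : E) (t : D), dd c = 0 /\ x = q c + dd t).
Proof.
split=> [[g gK Kg]|[qI qS]].
- split=> [v x /cycP [z <-] qz|v /cycP [z <-]].
    have : homology_class z = homology_class (0 : cycles E).
      apply: (can_inj gK); rewrite !homology_mapE; apply/homology_class_eq.
      by exists x; rewrite !cyc_map qz !raddf0 addr0.
    by move=> /homology_class_eq [y ey]; exists y; rewrite ey raddf0 addr0.
  have [c ec] := homology_class_surj (g (homology_class z)).
  have := Kg (homology_class z).
  rewrite ec homology_mapE => /homology_class_eq [t et].
  exists (cyc c), (- t); split; first exact: dd_cyc.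
  by rewrite linearN et cyc_map opprB addrC subrK.
- have inj : injective (homology_map q).
    move=> x1 x2; have [z1 ->] := homology_class_surj x1.
    have [z2 ->] := homology_class_surj x2.
    rewrite !homology_mapE => /homology_class_eq [v]; rewrite !cyc_map -raddfB => ev.
    apply/homology_class_eq; apply: (qI _ v) => //.
    by rewrite linearB !dd_cyc subr0.
  have /choice [g gK] : forall x, exists y, homology_map q y = x.
    move=> x; have [z ->] := homology_class_surj x.
    have [c [t [/cycP [z' <-] e]]] := qS _ (dd_cyc z).
    exists (homology_class z'); rewrite homology_mapE; apply/homology_class_eq.
    by exists (- t); rewrite linearN cyc_map e opprD addrA subrr sub0r.
  by exists g => // x; apply: inj; rewrite gK.
Qed.

End QuasiIso.
Arguments cyc {S a D} : simpl never.

(** Coordinate form of a free flag: the differential of a generator involves only strictly lower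
    levels. *)
Definition flag_basis (S : gring) (a : int) (G : dmod S a) (I : finType)
    (B : hbasis G I) (lv : I -> nat) : Prop :=
  forall x y, (lv x <= lv y)%N -> hco B y (dd (B x)) = 0.

(* The element-wise form of "a map from a flag to the mapping cone of a
   quasi-isomorphism is null-homotopic". *)
Lemma flag_lift (S : gring) (a : int) (D E G : dmod S a) (q : dhom E D)
    (I : finType) (B : hbasis G I) (lv : I -> nat) (s : S) (k : int)
    (u : {linear G -> E}) (w : {linear G -> D}) :
  flag_basis B lv -> quasi_iso q ->
  homdeg (k + a) u -> homdeg k w -> rgr 0%N s ->
  (forall v, dd (u v) = - (s *: u (dd v))) ->
  (forall v, q (u v) + dd (w v) = s *: w (dd v)) ->
  exists (h1 : {linear G -> E}) (h2 : {linear G -> D}),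
    [/\ homdeg k h1, homdeg (k - a) h2,
        forall v, u v = - dd (h1 v) + s *: h1 (dd v)
      & forall v, w v = q (h1 v) + dd (h2 v) + s *: h2 (dd v)].
Proof.
move=> hB /quasi_isoP [qI qS] hu hw s0 du dw.
pose P (t1 : I -> E) (t2 : I -> D) x :=
  u (B x) = - dd (t1 x) + s *: hext B t1 (dd (B x)) /\
  w (B x) = q (t1 x) + dd (t2 x) + s *: hext B t2 (dd (B x)).
(* Induction on the level: the degrees are prescribed on all generators, with value [0] where
   nothing is chosen yet, and the equations only on levels below [p]. *)
suff H p : exists (t1 : I -> E) (t2 : I -> D),
    (forall x, gr (hdeg B x + k) (t1 x)) /\
    (forall x, gr (hdeg B x + (k - a)) (t2 x)) /\
    forall x, (lv x < p)%N -> P t1 t2 x.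
  have [t1 [t2 [g1 [g2 H12]]]] := H (\max_x lv x).+1.
  have {}H12 x : P t1 t2 x by apply: H12; rewrite ltnS leq_bigmax.
  exists (hext B t1), (hext B t2); split; try exact: hext_deg.
    move=> v; pose f := \- (@dd _ _ E \o hext B t1) \+ (s \*: (hext B t1 \o @dd _ _ G)).
    apply: (@hb_ext _ _ _ B _ u f) => x; rewrite /f /= hextE.
    by case: (H12 x).
  move=> v; pose f := (q \o hext B t1) \+ (@dd _ _ D \o hext B t2) \+
    (s \*: (hext B t2 \o @dd _ _ G)).
  apply: (@hb_ext _ _ _ B _ w f) => x; rewrite /f /= !hextE.
  by case: (H12 x).
elim: p => [|p [t1 [t2 [g1 [g2 IH]]]]].
  exists (fun=> 0), (fun=> 0); split; [|split] => // x; exact: gr0.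
have step x : exists yt : E * D,
    [/\ gr (hdeg B x + k) yt.1, gr (hdeg B x + (k - a)) yt.2 & lv x = p ->
      u (B x) = - dd yt.1 + s *: hext B t1 (dd (B x)) /\
      w (B x) = q yt.1 + dd yt.2 + s *: hext B t2 (dd (B x))].
  case: (eqVneq (lv x) p) => [xp|/eqP nxp]; last by exists (0, 0); split=> //; exact: gr0.
  set n := hdeg B x; set z := dd (B x).
  (* Only levels below [p] occur in [z], and there the equations already hold. *)
  have below y : hco B y z = 0 \/ P t1 t2 y.
    case: (leqP p (lv y)) => py; last by right; exact: IH.
    by left; apply: hB; rewrite xp.
  have dz : dd z = 0 by exact: ddK.
  have uz : u z = - dd (hext B t1 z).
    pose f := \- (@dd _ _ E \o hext B t1) \+ (s \*: (hext B t1 \o @dd _ _ G)).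
    rewrite (_ : u z = f z); first by rewrite /f /= dz linear0 scaler0 addr0.
    apply: (hb_ext_at (B := B)) => y; rewrite /f /= hextE.
    by case: (below y) => [->|[-> _]]; [left|right].
  have wz : w z = q (hext B t1 z) + dd (hext B t2 z).
    pose f := (q \o hext B t1) \+ (@dd _ _ D \o hext B t2) \+
      (s \*: (hext B t2 \o @dd _ _ G)).
    rewrite (_ : w z = f z); first by rewrite /f /= dz linear0 scaler0 addr0.
    apply: (hb_ext_at (B := B)) => y; rewrite /f /= !hextE.
    by case: (below y) => [->|[_ ->]]; [left|right].
  (* The right-hand side is a cycle whose image under [q] bounds; injectivity on homology solves the
     first equation. *)
  have [y0 ey0] : exists y0, dd y0 = s *: hext B t1 z - u (B x).
    apply: (qI _ (w (B x) - s *: hext B t2 z)).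
      by rewrite linearB linearZ /= du -/z uz scalerN opprK subrr.
    rewrite !linearB !linearZ /=.
    have := dw (B x); rewrite -/z wz scalerDr => /(canRL (addKr _)) ->.
    by rewrite scalerN [in RHS]addrA addrK addrC.
  (* The remaining error in the second equation is a cycle; surjectivity on homology absorbs it, and
     adding the cycle [c] to [y0] does not disturb the first equation. *)
  have [c [t [dc ect]]] : exists (c : E) (t : D), dd c = 0 /\
      w (B x) - q y0 - s *: hext B t2 z = q c + dd t.
    apply: qS; rewrite !linearB !linearZ /= -dhom_dd ey0 linearB linearZ /=.
    have := dw (B x); rewrite -/z wz scalerDr => /(canRL (addKr _)) ->.
    by rewrite scalerN opprB addrACA addNr add0r -addrA -opprD subrr.
  pose y := y0 + c.
  have e1 : u (B x) = - dd y + s *: hext B t1 z.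
    by rewrite linearD dc addr0 ey0 opprB subrK.
  have e2 : w (B x) = q y + dd t + s *: hext B t2 z.
    by rewrite linearD -addrA -addrA [_ + (dd t + _)]addrA -ect subrK addrC subrK.
  (* Both equations are homogeneous, so the components of [y] and [t] in the expected degrees solve
     them too. *)
  exists (mcomp y (n + k), mcomp t (n + (k - a))).
  split; [exact: mcomp_in|exact: mcomp_in|move=> _ /=].
  have gz : gr (n + a) z by apply: dd_deg; exact: hb_gr.
  have gs j (V : gmod S) (v : V) : gr j v -> gr j (s *: v).
    by move=> gv; have := grZ s0 gv; rewrite add0r.
  have gh1 : gr (n + k + a) (s *: hext B t1 z).
    by apply: gs; rewrite addrAC; apply: hext_deg.
  have gh2 : gr (n + k) (s *: hext B t2 z).
    by apply: gs; have := hext_deg g2 gz; rewrite addrACA subrr addr0.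
  have dE : homdeg a (@dd _ _ E) by exact: dd_deg.
  have dD : homdeg a (@dd _ _ D) by exact: dd_deg.
  have hq : homdeg 0 q by move=> m v; rewrite addr0; exact: ghom_deg.
  split.
    rewrite -(mcomp_hom _ _ dE) -[LHS](@mcomp_id _ _ _ (n + k + a)).
      rewrite e1 /mcomp componentD; congr (_ + _); last exact: mcomp_id.
      by rewrite -[- _]sub0r componentB component0 sub0r.
    by have := hu _ _ (hb_gr B x); rewrite addrA.
  rewrite -(mcomp_hom _ _ hq) -(mcomp_hom _ _ dD) addr0 addrA subrK.
  rewrite -[LHS](@mcomp_id _ _ _ (n + k)); last exact: hw (hb_gr B x).
  by rewrite e2 /mcomp !componentD; congr (_ + _); exact: mcomp_id.
have /choice [f fP] := step.
pose pick (T : Type) (t t' : I -> T) x := if lv x == p then t' x else t x.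
(* New values on level [p] are not seen by differentials of generators of level at most [p], so
   earlier equations persist. *)
have hext_pick (V : gmod S) (t t' : I -> V) x : (lv x <= p)%N ->
    hext B (pick _ t t') (dd (B x)) = hext B t (dd (B x)).
  move=> xp; rewrite !hext_sum; apply: eq_bigr => y _; rewrite /pick; case: eqP => // yp.
  by rewrite hB ?scale0r // yp.
exists (pick _ t1 (fun x => (f x).1)), (pick _ t2 (fun x => (f x).2)).
split; [|split] => x; rewrite /pick; first by case: eqP => _; have [] := fP x.
  by case: eqP => _; have [] := fP x.
rewrite ltnS => xp; rewrite /P -!/(pick _ _ _) !hext_pick //.
rewrite /pick; case: eqP => [e|/eqP ne]; first by have [_ _ /(_ e)] := fP x.
by apply: IH; rewrite ltn_neqAle ne.
Qed.

(** * Bases of free flags *)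

Lemma linear_mk (R : pzRingType) (V W : lmodType R) (f : V -> W) :
  linear f -> exists g : {linear V -> W}, g =1 f.
Proof.
move=> fl; pose g : {linear V -> W} := HB.pack f (GRing.isLinear.Build R V W _ f fl).
by exists g.
Qed.

(** Independence makes the chosen coefficients unique, hence linear in the vector. *)
Lemma hbasis_intro (S : gring) (V : gmod S) (I : finType) (e : I -> V)
    (deg : I -> int) :
  (forall v, exists c : I -> S, v = \sum_x c x *: e x) ->
  (forall c : I -> S, \sum_x c x *: e x = 0 -> forall x, c x = 0) ->
  (forall x, gr (deg x) (e x)) ->
  exists B : hbasis V I, (forall x, B x = e x) /\ (forall x, hdeg B x = deg x).
Proof.
move=> /choice [c ce] indep ge.
have cu v (d : I -> S) x : v = \sum_x d x *: e x -> c v x = d x.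
  move=> ev; apply/eqP; rewrite -subr_eq0; apply/eqP.
  apply: (indep (fun x => c v x - d x)); under eq_bigr do rewrite scalerBl.
  by rewrite sumrB -ce -ev subrr.
have /choice [co coE] x : exists g : {linear V -> S^o}, forall v, g v = c v x.
  apply: linear_mk => s u v; apply: (cu _ (fun y => s * c u y + c v y)).
  rewrite {1}(ce u) {1}(ce v) scaler_sumr -big_split; apply: eq_bigr => y _.
  by rewrite scalerDl scalerA.
have ex v : v = \sum_x co x v *: e x by rewrite {1}(ce v); apply: eq_bigr => x _; rewrite coE.
have de x y : co y (e x) = (x == y)%:R.
  rewrite coE (cu _ (fun y => (x == y)%:R)) // (bigD1 x) //= eqxx scale1r.
  by rewrite big1 ?addr0 // => z; rewrite eq_sym => /negbTE ->; rewrite scale0r.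
by exists (HBasis ex de ge).
Qed.

Lemma componentZ (S : gring) (V : gmod S) (I : eqType) (P : I -> gsubmod V)
    (dP : direct_sum (fun i => gsub_set (P i))) (s : S) v i :
  component dP (s *: v) i = s *: component dP v i.
Proof.
rewrite (@component_uniq _ _ _ dP _ (fun i => s *: component dP v i)) //.
split=> [j|]; first by exact/rpredZ/(component_in dP v j).
have [r [ur zr ev]] := component_sum dP v.
exists r; split=> // [j /zr ->|]; first exact: scaler0.
by rewrite {1}ev scaler_sumr.
Qed.

(** Finitely many generators have components in finitely many pieces altogether, and taking
    components is linear. *)
Lemma free_flag_bounded (S : gring) (V : gmod S) (P : int -> gsubmod V) :
  fin_gen V -> direct_sum (fun i => gsub_set (P i)) ->
  exists N : nat, forall (i : int) v, (N%:Z <= i) -> gsub_set (P i) v -> v = 0.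
Proof.
move=> [n [e eV]] dP.
have /choice [s sP] l := component_sum dP (e l).
pose b := \max_(l < n) \max_(i <- s l) absz i.
exists b.+1 => i v bi Pv; have [c ec] := eV v.
have := component_hom dP i Pv; rewrite eqxx => <-.
rewrite ec component_big big1 // => l _; rewrite componentZ.
have [_ z _] := sP l; rewrite z ?scaler0 //.
apply/negP => il; have : (absz i <= b)%N.
  apply: leq_trans (leq_bigmax l).
  by rewrite (big_rem i il) /= leq_maxl.
by move: bi; lia.
Qed.

Section FlagBasis.
Variables (S : gring) (a : int) (G : dmod S a).

(** The bases of the finitely many nonzero pieces, put together, form a basis; the level of an
    element is the index of its piece. *)
Lemma free_flag_basis : fin_gen G -> free_flag G ->
  exists (I : finType) (B : hbasis G I) (lv : I -> nat), flag_basis B lv.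
Proof.
move=> fG [P [dP fP nP ddP]].
have [N PN] := free_flag_bounded fG dP.
have /choice [t tP] (p : 'I_N) : exists t : {n : nat & ('I_n -> G) * ('I_n -> int)}%type,
    homogeneous_basis (gsub_set (P (val p)%:Z)) (tagged t).1 (tagged t).2.
  have [n [e [deg h]]] := fP (val p)%:Z.
  by exists (Tagged (fun n => ('I_n -> G) * ('I_n -> int))%type (e, deg)).
pose I : finType := {p : 'I_N & 'I_(tag (t p))}.
pose tg p (l : 'I_(tag (t p))) : I := existT _ p l.
pose e (x : I) : G := (tagged (t (tag x))).1 (tagged x).
pose deg (x : I) : int := (tagged (t (tag x))).2 (tagged x).
pose lv (x : I) : nat := val (tag x).
have sumI (c : I -> S) :
    \sum_x c x *: e x = \sum_(p < N) \sum_(l < tag (t p)) c (tg p l) *: (tagged (t p)).1 l.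
  by rewrite sig_big_dep; apply: eq_big => -[].
(* The last clause, on vanishing coefficients, is what yields the flag condition at the end. *)
have expand v w : decomposes (fun i => gsub_set (P i)) v w -> exists c : I -> S,
    v = \sum_x c x *: e x /\ forall x, w (lv x)%:Z = 0 -> c x = 0.
  move=> [Pw [s [us zs ev]]].
  have /choice [c cP] (p : 'I_N) : exists c : nat -> S,
      w (val p)%:Z = \sum_(l < tag (t p)) c l *: (tagged (t p)).1 l /\
      (w (val p)%:Z = 0 -> forall l, c l = 0).
    case: (eqVneq (w (val p)%:Z) 0) => [->|nz].
      by exists (fun=> 0); split=> //; rewrite big1 // => l _; rewrite scale0r.
    have [[_ /(_ _ (Pw (val p)%:Z)) [c [ec _]]] _] := tP p.
    exists (fun l => if insub l is Some l' then c l' else 0); split.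
      by rewrite ec; apply: eq_bigr => l _; rewrite valK.
    by move=> e0; rewrite e0 eqxx in nz.
  exists (fun x : I => c (tag x) (nat_of_ord (tagged x))); split.
    rewrite sumI; transitivity (\sum_(p < N) w (val p)%:Z).
      rewrite ev -(big_mkord xpredT (fun p => w p%:Z)) /index_iota subn0.
      rewrite -(big_map Posz xpredT w); apply: fin_sum_eq => //.
        by rewrite map_inj_uniq ?iota_uniq // => i j [].
      move=> i ni; case: (ltrP i 0) => i0; first exact: nP (Pw i).
      apply: PN (Pw i); rewrite leNgt; apply: contraNN ni => iN.
      apply/mapP; exists (absz i); last by lia.
      by rewrite mem_iota; lia.
    by apply: eq_bigr => p _; have [] := cP p.
  by move=> x wx; have [_ ->] := cP (tag x).
have indep c : \sum_x c x *: e x = 0 -> forall x, c x = 0.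
  rewrite sumI => c0.
  pose b p := \sum_(l < tag (t p)) c (tg p l) *: (tagged (t p)).1 l.
  have Pb p : gsub_set (P (val p)%:Z) (b p).
    by apply: rpred_sum => l _; apply: rpredZ; have [[h _] _] := tP p; exact: h.
  (* Grouping the relation by levels decomposes [0]; uniqueness kills every [b p], and the bases of
     the pieces then kill the coefficients. *)
  pose w (i : int) := \sum_(p < N | (val p)%:Z == i) b p.
  have wE p : w (val p)%:Z = b p by rewrite /w (big_pred1 p).
  have dw : decomposes (fun i => gsub_set (P i)) 0 w.
    split=> [i|]; first by apply: rpred_sum => p /eqP <-; exact: Pb.
    exists [seq (val p)%:Z | p <- enum 'I_N]; split.
    - by rewrite map_inj_uniq ?enum_uniq // => p q [] /val_inj.
    - move=> i ni; rewrite /w big_pred0 // => p; apply: contraNF ni => /eqP <-.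
      by apply: map_f; rewrite mem_enum.
    - by rewrite big_map big_enum; apply: (etrans (esym c0)); apply: eq_bigr => p _; rewrite wE.
  have b0 p : b p = 0 by rewrite -wE -(component_uniq dP dw) component0.
  move=> [p l]; have [[_ /(_ _ (Pb p)) [d [_ du]]] _] := tP p.
  pose cp : {ffun 'I_(tag (t p)) -> S} := [ffun l => c (tg p l)].
  have := du cp; rewrite b0 => d1; have := du [ffun=> 0]; rewrite b0 => d2.
  have : d l = c (tg p l).
    rewrite d1 ?ffunE //; apply: (etrans (esym (b0 p))).
    by apply: eq_bigr => k _; rewrite ffunE.
  move=> <-; rewrite d2 ?ffunE // big1 // => k _.
  by rewrite ffunE scale0r.
have [B [Be Bdeg]] : exists B : hbasis G I,
    (forall x, B x = e x) /\ (forall x, hdeg B x = deg x).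
  apply: hbasis_intro indep _ => [v|x]; last by have [_] := tP (tag x); exact.
  by have [c [ev _]] := expand _ _ (componentP dP v); exists c.
exists I, B, lv => x y xy.
have Pex : gsub_set (P (lv x)%:Z) (B x) by rewrite Be; have [[h _] _] := tP (tag x); exact: h.
have [w [dw w0]] := ddP _ _ Pex; have [c [-> c0]] := expand _ _ dw.
under eq_bigr do rewrite -Be.
by rewrite hco_sum; apply/c0/w0; rewrite lez_nat.
Qed.

End FlagBasis.

(** * Comparison of minimal free resolutions *)

Section Comparison.
Variables (S : glring) (a : int) (D : dmod S a).

(** Only the flag [G] has the lifting property: [flag_lift] with [s = 1] and [u = 0] lifts [q]
    through [f'] up to homotopy, and restriction along [i] gives the map on [F]. *)
Lemma resolution_lift (F F' : dmod S a) (f : dhom F D) (f' : dhom F' D) :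
  minimal_free_resolution f -> quasi_iso f' ->
  exists (g : {linear F -> F'}) (h : {linear F -> D}),
    [/\ homdeg 0 g, homdeg (0 - a) h, forall v, dd (g v) = g (dd v)
      & forall v, f v = f' (g v) + dd (h v) + h (dd v)].
Proof.
move=> [qf _ _ [G [i [r [q [fG flG ri qq fE]]]]]] qf'.
have [I [B [lv hB]]] := free_flag_basis fG flG.
have h0 : homdeg (0 + a) (\0 : {linear G -> F'}) by move=> n v _; exact: gr0.
have hq : homdeg 0 q by move=> n v; rewrite addr0; exact: ghom_deg.
have [v|v|g [h [dg dh e1 e2]]] := flag_lift hB qf' h0 hq (rgr1 S).
- by rewrite /= linear0 scaler0 oppr0.
- by rewrite /= linear0 add0r scale1r dhom_dd.
exists (g \o i), (h \o i); split=> [n v gv|n v gv|v|v] /=.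
- by apply: dg; exact: ghom_deg.
- by apply: dh; exact: ghom_deg.
- have := e1 (i v); rewrite scale1r => /esym/eqP.
  by rewrite addrC subr_eq0 dhom_dd => /eqP.
- by rewrite fE e2 scale1r dhom_dd.
Qed.

(** The map [g] is carried to the flag as [g \o r], where [flag_lift] with [s = -1] provides the
    null-homotopy, and brought back by [r (i x) = x]. *)
Lemma resolution_homotopy (F : dmod S a) (f : dhom F D)
    (g : {linear F -> F}) (h : {linear F -> D}) :
  minimal_free_resolution f -> homdeg 0 g -> homdeg (0 - a) h ->
  (forall v, dd (g v) = g (dd v)) ->
  (forall v, f (g v) = dd (h v) + h (dd v)) ->
  exists s : {linear F -> F}, forall v, g v = dd (s v) + s (dd v).
Proof.
move=> [qf _ _ [G [i [r [q [fG flG ri qq fE]]]]]] dg dh cg fg.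
have [I [B [lv hB]]] := free_flag_basis fG flG.
have dgr : homdeg (0 - a + a) (g \o r).
  by move=> n v gv /=; rewrite subrK; apply: dg; exact: ghom_deg.
have dhr : homdeg (0 - a) (\- (h \o r)).
  by move=> n v gv /=; apply/grN/dh; exact: ghom_deg.
have N1 : rgr 0%N (-1 : S).
  rewrite -sub0r; apply: (direct_sumB (rgr_sum S)); last exact: rgr1.
  exact: (direct_sum0 (rgr_sum S)).
have [v|v|s [t [_ _ e _]]] := flag_lift hB qf dgr dhr N1.
- by rewrite /= scaleN1r opprK cg dhom_dd.
- by rewrite /= fg scaleN1r opprK dhom_dd linearN addrAC subrr add0r.
exists (\- (s \o i)) => v /=.
by have := e (i v); rewrite /= ri scaleN1r linearN dhom_dd.
Qed.

Lemma minimal_maxid (F : dmod S a) (v : F) : minimal F -> residue_pi (dd v) = 0.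
Proof. by move=> mF; have := mF (residue_pi v); rewrite /= /residue_dd residue_mapE. Qed.

(** Comparison maps in both directions compose to a map homotopic to the identity. Between minimal
    modules a homotopy vanishes modulo the maximal ideal, so the composite is the identity on
    residues. *)
Lemma residue_embed (F F' : dmod S a) (f : dhom F D) (f' : dhom F' D) :
  minimal_free_resolution f -> minimal_free_resolution f' ->
  exists t : {linear residue_gmod F -> residue_gmod F'}, injective t /\ homdeg 0 t.
Proof.
move=> rf rf'; have [qf _ mF _] := rf; have [qf' _ mF' _] := rf'.
have [g [h [dg dh cg gE]]] := resolution_lift rf qf'.
have [g' [h' [dg' dh' cg' gE']]] := resolution_lift rf' qf.
have [|||v|s sE] := @resolution_homotopy F f ((g' \o g) \- idfun) (\- h \- (h' \o g)) rf.
- move=> n v gv /=; apply: grB; last by rewrite addr0.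
  by rewrite -[n + 0]addr0; apply/dg'/dg.
- move=> n v gv /=; apply: grB; first exact/grN/dh.
  by apply: dh'; rewrite -[n]addr0; exact: dg.
- by move=> v /=; rewrite linearB /= cg' cg.
- rewrite /= linearB [dd _]linearB linearN (gE v) (gE' (g v)) cg.
  by rewrite !opprD !addrA subrr add0r [LHS](ACl (3*1*4*2)).
exists (residue_map g); split; last first.
  move=> n _ [v gv ->] /=; rewrite residue_mapE; exists (g v) => //.
  exact: dg.
apply: (can_inj (g := residue_map g')) => x; have [v ->] := residue_pi_surj x.
rewrite -[LHS]/(residue_map g' (residue_map g (residue_pi v))).
rewrite (residue_mapE g v) (residue_mapE g' (g v)).
apply/residue_pi_eq/residue_pi_eq0.
have -> : g' (g v) - v = dd (s v) + s (dd v) by exact: sE v.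
rewrite residue_piD minimal_maxid // add0r.
by rewrite -residue_mapE minimal_maxid // linear0.
Qed.
End Comparison.

Fact homology_class_linear (S : gring) (a : int) (D : dmod S a) :
  linear (@homology_class S a D).
Proof.
move=> c u v; pose pD := @Defs.pi_add _ _ (boundary_submod D) (c *: u) v.
pose pZ := @Defs.pi_scale _ _ (boundary_submod D) c u.
exact: (etrans pD (congr1 (+%R^~ _) (esym pZ))).
Qed.
HB.instance Definition _ (S : gring) (a : int) (D : dmod S a) :=
  GRing.isLinear.Build S (cycles D) (homology D) _ (@homology_class S a D)
    (@homology_class_linear S a D).

(** The residue differential is zero, so the only boundary is [0]. *)
Lemma minimal_homology_class (S : glring) (a : int) (F : dmod S a)
    (z : cycles (residue_dmod F)) :
  minimal F -> (homology_class z = 0 <-> cyc z = 0).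
Proof.
move=> mF; rewrite -[X in _ = X <-> _](linear0 (@homology_class _ a (residue_dmod F))).
split=> [/homology_class_eq [v]|z0]; first by rewrite mF !linear0 addr0.
by apply/homology_class_eq; exists 0; rewrite z0 !linear0 addr0.
Qed.

(** By minimality the homology of a residue is the residue itself, so [t] induces an injection
    between the degree [j] parts, of dimensions [b] and [b']. *)
Lemma betti_le (S : glring) (a : int) (F F' : dmod S a) (j : int) (b b' : nat)
    (t : {linear residue_gmod F -> residue_gmod F'})
    (e : 'I_b -> homology (residue_dmod F))
    (e' : 'I_b' -> homology (residue_dmod F')) :
  minimal F -> minimal F' -> injective t -> homdeg 0 t ->
  is_basis (gr j) e -> is_basis (gr j) e' -> (b <= b')%N.
Proof.
move=> mF mF' tI dt [ge ue] [ge' ue'].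
have /choice [z zP] l : exists z : cycles (residue_dmod F),
    gr j (cyc z) /\ e l = homology_class z.
  by have [z gz ez] := ge l; exists z.
have /choice [y yP] l : exists y : cycles (residue_dmod F'),
    cyc y = t (cyc (z l)) /\ gr j (homology_class y).
  have [y ey] := cycP (D := residue_dmod F') (mF' (t (cyc (z l)))).
  exists y; split=> //; exists y => //.
  have : @gr _ (residue_gmod F') j (cyc y); last by [].
  rewrite ey.
  by have [/dt] := zP l; rewrite addr0.
have /choice [c cE] l : exists c : {ffun 'I_b' -> resfield S},
    homology_class (y l) = \sum_i c i *: e' i.
  by have [_ /ue' [c [ec _]]] := yP l; exists c.
rewrite leqNgt; apply/negP => bb.
(* With [b' < b] the coordinate matrix of the images has more rows than columns; a nonzero row
   vector killing it gives a relation among the [e l]. *)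
pose C := \matrix_(l < b, i < b') c l i.
have /rowV0Pn [v /sub_kermxP vC v0] : kermx C != 0.
  rewrite kermx_eq0 /row_free; apply: contraTN bb => /eqP <-.
  by rewrite -leqNgt rank_leq_col.
suff v0' : v = 0 by rewrite v0' eqxx in v0.
have ty : homology_class (\sum_l v ord0 l *: y l) = 0.
  rewrite linear_sum; under eq_bigr do rewrite linearZ /= cE scaler_sumr.
  rewrite exchange_big big1 //= => i _.
  under eq_bigr do rewrite scalerA.
  rewrite -scaler_suml (_ : \sum_l _ = 0) ?scale0r //.
  have := congr1 (fun A : 'M_(_, _) => A ord0 i) vC; rewrite !mxE => e0; apply: etrans e0.
  by apply: eq_bigr => l _; rewrite mxE.
have z0 : cyc (\sum_l v ord0 l *: z l) = 0.
  apply: tI; rewrite linear0; move/minimal_homology_class: ty => /(_ mF') y0; apply: etrans y0.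
  rewrite !linear_sum; apply: eq_bigr => l _; rewrite !linearZ /=.
  by have [-> _] := yP l.
have : \sum_l v ord0 l *: e l = 0.
  move/(minimal_homology_class _ mF): z0 => z0; apply: etrans z0.
  rewrite linear_sum; apply: eq_bigr => l _; rewrite linearZ /=.
  by have [_ ->] := zP l.
have [d [_ du]] := ue _ (gr0 (homology (residue_dmod F)) j).
move=> /esym v1; apply/rowP => l; rewrite mxE.
have d0 : d = [ffun=> 0].
  by apply: du; rewrite big1 // => k _; rewrite ffunE scale0r.
have /(congr1 (fun f : {ffun _} => f l)) : d = [ffun l => v ord0 l].
  by apply: du; apply: (etrans v1); apply: eq_bigr => k _; rewrite ffunE.
by rewrite d0 !ffunE.
Qed.

(** * Free flags built from homogeneous bases *)

Section GradedFreeBasis.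
Variables (S : gring) (I : finType) (deg : I -> int).

Definition gfree_co (x : I) (v : gfree S deg) : S^o := v x.
Fact gfree_co_linear x : linear (gfree_co x).
Proof. by move=> c u v; rewrite /gfree_co !ffunE. Qed.
HB.instance Definition _ x :=
  GRing.isLinear.Build S (gfree S deg) S^o _ (gfree_co x) (gfree_co_linear x).

Definition gfree_vec (x : I) : gfree S deg := [ffun y => (x == y)%:R].

Fact gfree_expand v : v = \sum_x gfree_co x v *: gfree_vec x.
Proof.
apply/ffunP => y; rewrite sum_ffunE (bigD1 y) //= big1 => [|x /negbTE xy].
  by rewrite !ffunE eqxx addr0; exact: esym (mulr1 _).
by rewrite !ffunE xy; exact: mulr0.
Qed.

Fact gfree_co_vec x y : gfree_co y (gfree_vec x) = (x == y)%:R.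
Proof. by rewrite /gfree_co ffunE. Qed.

Fact gfree_vec_gr x : gr (deg x) (gfree_vec x).
Proof.
move=> y; rewrite ffunE; case: eqP => [->|_]; last exact: (direct_sum0 (hgr_sum S)).
by rewrite subrr; exact: rgr1.
Qed.

Definition gfree_basis : hbasis (gfree S deg) I :=
  HBasis gfree_expand gfree_co_vec gfree_vec_gr.

End GradedFreeBasis.

Section FlagOfBasis.
Variables (S : gring) (V : gmod S) (I : finType) (B : hbasis V I).

Lemma hbasis_graded_free (A : pred I) (U : set V) :
  (forall v, U v <-> forall x, ~~ A x -> hco B x v = 0) -> graded_free U.
Proof.
move=> UE; exists #|A|, (fun i => B (enum_val i)), (fun i => hdeg B (enum_val i)).
split; last by move=> l; exact: hb_gr.
split=> [i|v /UE Uv].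
  apply/UE => x Ax; rewrite hco_basis; case: eqP => // e.
  by have := enum_valP i; rewrite e unfold_in (negbTE Ax).
exists [ffun i => hco B (enum_val i) v]; split.
  transitivity (\sum_(x in A) hco B x v *: B x).
    rewrite [RHS]big_mkcond {1}(hb_expand B v); apply: eq_bigr => x _.
    by case: ifPn => // Ax; rewrite Uv ?scale0r.
  by rewrite big_enum_val; apply: eq_bigr => i _; rewrite ffunE.
move=> c ev; apply/ffunP => i; rewrite ffunE ev linear_sum (bigD1 i) //=.
rewrite big1 => [|k ki]; rewrite linearZ /= hco_basis.
  by rewrite eqxx addr0; exact: mulr1.
by rewrite (inj_eq enum_val_inj) (negbTE ki); exact: mulr0.
Qed.

Lemma hbasis_fin_gen : fin_gen V.
Proof.
have [n [e [deg [[_ eV] _]]]] : graded_free [set: V].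
  by apply: (@hbasis_graded_free xpredT) => v; split.
by exists n, e => v; have [c [ev _]] := eV v Logic.I; exists c.
Qed.

Variable lv : I -> nat.

(** The span of the basis elements of level [i], cut out by the vanishing of the other coordinates;
    it is zero for negative [i]. *)
Definition level_pred (i : int) (v : V) : bool :=
  [forall x, ((lv x)%:Z != i) ==> (hco B x v == 0)].

Lemma level_predP i v :
  reflect (forall x, (lv x)%:Z != i -> hco B x v = 0) (level_pred i v).
Proof.
apply: (iffP forallP) => [h x xi|h x]; first exact/eqP/(implyP (h x)).
by apply/implyP => /h ->.
Qed.

Fact level_closed i : submod_closed (level_pred i).
Proof.
split=> [|c u v /level_predP u0 /level_predP v0]; apply/level_predP => x xi.
  exact: linear0.
by rewrite linearP u0 ?v0 // scaler0 addr0.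
Qed.
HB.instance Definition _ i :=
  GRing.isSubmodClosed.Build S V (level_pred i) (level_closed i).
Definition level_submod i : submodClosed V :=
  GRing.SubmodClosed.clone S V (level_pred i) _.

Fact level_comp i (v : V) n : v \in level_submod i -> mcomp v n \in level_submod i.
Proof.
move=> /level_predP v0; apply/level_predP => x xi.
by rewrite hco_mcomp v0 // component0.
Qed.

Definition level_gsub i : gsubmod V := GSubmod (@level_comp i).

Definition level_part (v : V) (i : int) : V :=
  \sum_(x | (lv x)%:Z == i) hco B x v *: B x.

Lemma level_part_decomposes v :
  decomposes (fun i => gsub_set (level_gsub i)) v (level_part v).
Proof.
split=> [i|].
  apply: rpred_sum => x /eqP xi; apply: rpredZ; apply/level_predP => y yi.
  by rewrite hco_basis; case: eqP => // xy; rewrite -xy xi eqxx in yi.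
pose N := (\max_x lv x).+1; have lvN x : (lv x < N)%N by rewrite ltnS leq_bigmax.
exists [seq (val p)%:Z | p <- enum 'I_N]; split=> [|i ni|].
- by rewrite map_inj_uniq ?enum_uniq // => p q [] /val_inj.
- rewrite /level_part big_pred0 // => x; apply: contraNF ni => /eqP <-.
  by apply/mapP; exists (Ordinal (lvN x)); rewrite ?mem_enum.
- rewrite {1}(hb_expand B v) big_map big_enum.
  by rewrite (partition_big (fun x => Ordinal (lvN x)) xpredT).
Qed.

Lemma level_direct_sum : direct_sum (fun i => gsub_set (level_gsub i)).
Proof.
apply: direct_sum_intro => [i|i u v ui vi|v|w [Pw [s [us zs e]]] i].
- exact: rpred0.
- by rewrite /gsub_set; apply: rpredB.
- by exists (level_part v); exact: level_part_decomposes.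
- rewrite (hb_expand B (w i)) big1 // => x _.
  suff -> : hco B x (w i) = 0 by rewrite scale0r.
  case: (eqVneq (lv x)%:Z i) => [xi|xi]; last by move/level_predP: (Pw i); exact.
  case: (boolP (i \in s)) => [si|/zs ->]; last exact: linear0.
  have := congr1 (hco B x) e; rewrite linear0 linear_sum (bigD1_seq i) //= big1.
    by rewrite addr0 => /esym.
  by move=> k ki; move/level_predP: (Pw k); apply; rewrite xi eq_sym.
Qed.

End FlagOfBasis.

(** Converse of [free_flag_basis]: the spans of the levels are the pieces of the splitting. *)
Lemma flag_basis_free_flag (S : gring) (a : int) (G : dmod S a) (I : finType)
    (B : hbasis G I) (lv : I -> nat) :
  flag_basis B lv -> free_flag G.
Proof.
move=> hB; exists (level_gsub B lv); split=> [|i|i v i0 /level_predP v0|i v /level_predP v0].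
- exact: level_direct_sum.
- apply: (@hbasis_graded_free _ _ _ B (fun x => (lv x)%:Z == i)) => v.
  by split=> [/level_predP|v0]; last exact/level_predP.
- rewrite (hb_expand B v) big1 // => x _; rewrite v0 ?scale0r //.
  by apply: contraTneq i0 => <-; rewrite -leNgt.
- exists (level_part B lv (dd v)); split; first exact: level_part_decomposes.
  move=> j ij; rewrite /level_part big1 // => x /eqP xj.
  suff -> : hco B x (dd v) = 0 by rewrite scale0r.
  rewrite (hb_expand B v) !linear_sum big1 // => y _; rewrite !linearZ /=.
  case: (eqVneq (lv y)%:Z i) => [yi|yi]; last by rewrite v0 // scale0r.
  by rewrite hB ?scaler0 // -lez_nat yi xj.
Qed.

(** * Finiteness of the minimal resolution *)

Section LinearImage.
Variables (R : pzRingType) (A B : lmodType R) (g : {linear A -> B}).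
Definition limage_pred (b : B) : bool := `[< exists x, g x = b >].
Fact limage_closed : submod_closed limage_pred.
Proof.
split=> [|c u v /asboolP [x <-] /asboolP [y <-]]; apply/asboolP.
  by exists 0; exact: linear0.
by exists (c *: x + y); exact: linearP.
Qed.
HB.instance Definition _ := GRing.isSubmodClosed.Build R B limage_pred limage_closed.
Definition limage : submodClosed B := GRing.SubmodClosed.clone R B limage_pred _.

Lemma limage_factor (P : lmodType R) (f : {linear P -> B}) :
  (forall p, exists x, g x = f p) ->
  exists f' : {linear P -> sub_mod limage}, forall p, val (f' p) = f p.
Proof.
move=> fg; have fi p : f p \in limage by apply/asboolP.
have [p|f' f'E] := @linear_mk R P (sub_mod limage) (fun p => Sub (f p) (fi p)).
  by move=> u v; apply: val_inj; rewrite [RHS]linearP !SubK linearP.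
by exists f' => p; rewrite f'E SubK.
Qed.

(** Projectivity lifts along surjections, so both maps are first factored through the image of
    [g]. *)
Lemma projective_lift (P : lmodType R) (f : {linear P -> B}) :
  projective P -> (forall p, exists x, g x = f p) ->
  exists h : {linear P -> A}, forall p, g (h p) = f p.
Proof.
move=> projP fg; have [f' f'E] := limage_factor fg.
have [g' g'E] := limage_factor (fun p => ex_intro _ p (erefl (g p))).
have [b|h hE] := projP _ _ g' f'.
  have /asboolP [x gx] := valP b.
  by exists x; apply: val_inj; rewrite g'E.
by exists h => p; rewrite -g'E hE f'E.
Qed.

End LinearImage.

Lemma dependent_choice (T : nat -> Type) (Rel : forall i, T i -> T i.+1 -> Prop)
    (t0 : T 0%N) :
  (forall i t, exists t', Rel i t t') ->
  exists t : forall i, T i, t 0%N = t0 /\ forall i, Rel i (t i) (t i.+1).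
Proof.
move=> step; pose next i t := sval (cid (step i t)).
exists (fix t i := if i is j.+1 then next j (t j) else t0); split=> // i.
exact: (svalP (cid (step i _))).
Qed.

(* With [s = 1] and [t = 0] this extends chain maps; with [s = -1] it extends
   null-homotopies of the chain map [t]. *)
Lemma chain_extension (R : comNzRingType) (E Q : nat -> lmodType R)
    (dE : forall i, {linear E i.+1 -> E i}) (dQ : forall i, {linear Q i.+1 -> Q i})
    (s : R) (t : forall i, {linear E i.+1 -> Q i}) (h0 : {linear E 0%N -> Q 0%N}) :
  (forall i, projective (E i.+1)) ->
  (forall i x, dE i (dE i.+1 x) = 0) ->
  (forall i x, dQ i x = 0 -> exists y, dQ i.+1 y = x) ->
  (forall i x, dQ i (t i.+1 x) + s *: t i (dE i.+1 x) = 0) ->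
  (forall x, exists y, dQ 0%N y = t 0%N x + s *: h0 (dE 0%N x)) ->
  exists h : forall i, {linear E i -> Q i},
    h 0%N = h0 /\ forall i x, dQ i (h i.+1 x) = t i x + s *: h i (dE i x).
Proof.
move=> projE ddE exQ dt start.
(* Each map is carried along with the solvability of the equation for the next one. *)
pose T i := {h : {linear E i -> Q i} |
  forall x, exists y, dQ i y = t i x + s *: h (dE i x)}.
pose Rel i (h : T i) (h' : T i.+1) :=
  forall x, dQ i (sval h' x) = t i x + s *: sval h (dE i x).
have [i h|h [h0E hE]] := @dependent_choice T Rel (exist _ h0 start).
  pose f := t i \+ (s \*: (sval h \o dE i)).
  have [h' h'E] := projective_lift (g := dQ i) (f := f) (projE i) (svalP h).
  have h'T x : exists y, dQ i.+1 y = t i.+1 x + s *: h' (dE i.+1 x).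
    apply: exQ; rewrite linearD linearZ /= h'E /f /= ddE linear0 scaler0 addr0.
    exact: dt.
  by exists (exist _ h' h'T) => x; exact: h'E.
exists (fun i => sval (h i)); split; last exact: hE.
by rewrite h0E.
Qed.

Lemma hbasis_projective (S : gring) (V : gmod S) (I : finType) :
  hbasis V I -> projective V.
Proof.
move=> B A C g f gS; have /choice [t tE] x := gS (f (B x)).
exists (hext B t) => v; apply: (@hb_ext _ _ _ B _ (g \o hext B t)) => x /=.
by rewrite hextE.
Qed.

Section Maxid.
Variable S : glring.

Lemma maxid1 : (1 : S) \notin maxid_ideal S.
Proof. by rewrite idealr1. Qed.

Lemma linear_maxid (V : lmodType S) (f : {linear V -> S^o}) (v : V) :
  v \in maxid_submod V -> (f v : S) \in maxid_ideal S.
Proof.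
move=> /asboolP [s [ms ->]]; rewrite linear_sum big_seq; apply: rpred_sum => p sp.
have -> : f (p.1 *: p.2) = (f p.2 : S) * p.1 by rewrite linearZ; exact: mulrC.
by apply: idealMr; exact: ms.
Qed.

(** Compared with a projective resolution of length [n], the identity of [F] is homotopic to a map
    that vanishes beyond [n]. By minimality [F i] then equals its product with the maximal ideal,
    which excludes basis elements. *)
Lemma minimal_resolution_finite (M : gmod S) (F : nat -> gmod S)
    (d : forall i, ghom (F i.+1) (F i)) (aug : ghom (F 0%N) M)
    (I : nat -> finType) (B : forall i, hbasis (F i) (I i)) :
  resolves (F := fun i => F i : lmodType S) (fun i => ghom_fun (d i)) aug ->
  (forall i (x : residue (F i.+1)), residue_map (d i) x = 0) ->
  finite_proj_dim M ->
  exists N : nat, forall i (x : F i), (N <= i)%N -> x = 0.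
Proof.
move=> [augS aug0 dex] dmin [P [dP [augP [n [projP [augPS augP0 dPex] P0]]]]].
have projF i : projective (F i) := hbasis_projective (B i).
have dd0 i x : d i (d i.+1 x) = 0 by apply/dex; exists x.
have dPdP i x : dP i (dP i.+1 x) = 0 by apply/dPex; exists x.
have exF i x : d i x = 0 -> exists y, d i.+1 y = x by move/dex.
have exP i x : dP i x = 0 -> exists y, dP i.+1 y = x by move/dPex.
have [f0 f0E] := projective_lift (g := augP) (f := aug) (projF 0%N) (fun p => augPS _).
have [g0 g0E] := projective_lift (g := aug) (f := augP) (projP 0%N) (fun p => augS _).
have [i x|x|f [f0' fE]] := @chain_extension S (fun i => F i) P (fun i => d i) dP 1
    (fun i => \0) f0 (fun i => projF _) dd0 exP.
- by rewrite /= linear0 scaler0 addr0.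
- rewrite /= scale1r add0r; apply/augP0; rewrite f0E; apply/aug0; by exists x.
have [i x|x|g [g0' gE]] := @chain_extension S P (fun i => F i) dP (fun i => d i) 1
    (fun i => \0) g0 (fun i => projP _) dPdP exF.
- by rewrite /= linear0 scaler0 addr0.
- rewrite /= scale1r add0r; apply/aug0; rewrite g0E; apply/augP0; by exists x.
(* A chain map inducing zero on [M], hence null-homotopic; [h] is the homotopy. *)
pose c i : {linear F i -> F i} := (g i \o f i) \- idfun.
have cd i x : d i (c i.+1 x) = c i (d i x).
  rewrite /c /= linearB gE /= scale1r fE /= scale1r !add0r //.
have [x|h0 h0E] := projective_lift (g := d 0%N) (f := c 0%N) (projF 0%N).
  by apply/aug0; rewrite /c /= linearB g0' g0E f0' f0E subrr.
have [i x|x|h [_ hE]] := @chain_extension S (fun i => F i) (fun i => F i.+1)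
    (fun i => d i) (fun i => d i.+1) (-1) (fun i => c i.+1) h0
    (fun i => projF _) dd0 (fun i => @exF i.+1).
- by rewrite cd scaleN1r subrr.
- by apply: exF; rewrite scaleN1r linearB cd h0E subrr.
exists n.+2 => i x; case: i x => // i x ni.
have res0 (y : F i.+1) : residue_pi y = 0.
  have P0y : f i.+1 y = 0 by apply: P0; lia.
  (* Since [f] vanishes on [y], [c] sends [y] to [- y]; both terms of the homotopy lie in the
     multiples of the maximal ideal. *)
  have /(canRL (@opprK _)) e : - y = d i.+1 (h i.+1 y) + h i (d i y).
    by rewrite hE scaleN1r subrK /c /= P0y linear0 sub0r.
  apply/residue_pi_eq0; rewrite e -scaleN1r; apply: rpredZ; apply: rpredD.
    by apply/residue_pi_eq0; rewrite -residue_mapE.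
  by apply/residue_pi_eq0; rewrite -residue_mapE -residue_mapE dmin linear0.
rewrite (hb_expand (B i.+1) x) big1 // => k _; exfalso; apply/negP: maxid1.
have /residue_pi_eq0/(linear_maxid (hco (B i.+1) k)) := res0 (B i.+1 k).
by rewrite hco_basis eqxx => ->.
Qed.
End Maxid.

(** * Anchored resolutions *)

(* Homogeneous bases of all the [F i] at once: [tb i x] is a basis element of
   [F i] if [x] has level [i], and [0] otherwise. *)
Record total_basis (S : gring) (F : nat -> gmod S) (I : finType) := TotalBasis {
  tlv : I -> nat;
  tdeg : I -> int;
  tb : forall i, I -> F i;
  tco : forall i, I -> {linear F i -> S^o};
  tb0 : forall i x, tlv x != i -> tb i x = 0;
  tco0 : forall i x w, tlv x != i -> tco i x w = 0;
  tb_expand : forall i w, w = \sum_x tco i x w *: tb i x;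
  tco_basis : forall i x y, tlv x = i -> tco i y (tb i x) = (x == y)%:R;
  tb_gr : forall i x, gr (tdeg x) (tb i x) }.

Section Total.
Variables (S : gring) (F : nat -> gmod S) (I : finType) (T : total_basis F I).
Variable a : int.

(** The shift by the level times [a] turns the degree-preserving differential of [F], which lowers
    the level by one, into a map of degree [a]. *)
Definition total_mod : gmod S :=
  gfree S (fun x => tdeg T x - (tlv T x)%:Z * a).
Definition total_hbasis : hbasis total_mod I := gfree_basis S _.
Local Notation G := total_mod.
Local Notation gB := total_hbasis.
Local Notation lv := (tlv T).

Definition tproj (i : nat) : {linear G -> F i} := hext gB (tb T i).

Definition tincl_fun (i : nat) (w : F i) : G := \sum_x tco T i x w *: gB x.
Fact tincl_linear i : linear (@tincl_fun i).
Proof.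
move=> c u v; rewrite /tincl_fun scaler_sumr -big_split; apply: eq_bigr => x _.
by rewrite linearP scalerDl scalerA.
Qed.
HB.instance Definition _ i :=
  GRing.isLinear.Build S (F i) G _ (@tincl_fun i) (@tincl_linear i).
Definition tincl (i : nat) : {linear F i -> G} := @tincl_fun i.

(** The step [F_0 + ... + F_(p-1)] of the level filtration. *)
Definition supp_lt (p : nat) (v : G) : Prop :=
  forall x, (p <= lv x)%N -> hco gB x v = 0.

Lemma tproj_deg i : homdeg (i%:Z * a) (tproj i).
Proof.
apply: hext_deg => x; case: (eqVneq (lv x) i) => [<-|xi].
  by rewrite /= subrK; exact: tb_gr.
by rewrite tb0 //; exact: gr0.
Qed.

Lemma hco_tincl i (w : F i) x : hco gB x (tincl i w) = tco T i x w.
Proof. exact: hco_sum. Qed.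

Lemma tinclK i (w : F i) : tproj i (tincl i w) = w.
Proof. by rewrite [RHS](tb_expand T) hext_sum; apply: eq_bigr => x _; rewrite hco_tincl. Qed.

Lemma supp_lt_tincl i (w : F i) : supp_lt i.+1 (tincl i w).
Proof. by move=> x xi; rewrite hco_tincl tco0 // gtn_eqF. Qed.

Lemma supp_lt_le p q v : (p <= q)%N -> supp_lt p v -> supp_lt q v.
Proof. by move=> pq pv x qx; apply/pv/(leq_trans pq). Qed.

Lemma supp_lt0 v : supp_lt 0 v -> v = 0.
Proof. by move=> v0; rewrite (hb_expand gB v) big1 // => x _; rewrite v0 ?scale0r. Qed.

Lemma supp_ltB p u v : supp_lt p u -> supp_lt p v -> supp_lt p (u - v).
Proof. by move=> pu pv x px; rewrite linearB pu ?pv ?subr0. Qed.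

Lemma supp_ltD p u v : supp_lt p u -> supp_lt p v -> supp_lt p (u + v).
Proof. by move=> pu pv x px; rewrite linearD pu ?pv ?addr0. Qed.

Lemma supp_lt_mcomp p v n : supp_lt p v -> supp_lt p (mcomp v n).
Proof. by move=> pv x px; rewrite hco_mcomp pv // component0. Qed.

Lemma tproj_sup i v : supp_lt i v -> tproj i v = 0.
Proof.
move=> iv; rewrite hext_sum big1 // => x _.
case: (leqP i (lv x)) => xi; first by rewrite iv ?scale0r.
by rewrite tb0 ?scaler0 // ltn_eqF.
Qed.

Lemma tco_tproj i v x : lv x = i -> tco T i x (tproj i v) = hco gB x v.
Proof.
move=> xi; rewrite hext_sum linear_sum (bigD1 x) //= big1.
  by rewrite addr0 linearZ /= tco_basis // eqxx; exact: mulr1.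
move=> y yx; rewrite linearZ /=; case: (eqVneq (lv y) i) => [yi|yi].
  by rewrite tco_basis // (negbTE yx) scaler0.
by rewrite tb0 // linear0 scaler0.
Qed.

Lemma supp_lt_pred p v : supp_lt p.+1 v -> tproj p v = 0 -> supp_lt p v.
Proof.
move=> pv v0 x; rewrite leq_eqVlt => /orP [/eqP px|]; last exact: pv.
by rewrite -(tco_tproj v (esym px)) v0 linear0.
Qed.

Variables (M : gmod S) (d : forall i, ghom (F i.+1) (F i)) (aug : ghom (F 0%N) M).
Hypothesis res : resolves (F := fun i => F i : lmodType S) (fun i => ghom_fun (d i)) aug.
(** The map [kap] presents [M] as the homology of [E] through its cycles; this treats [D] and [H(D)]
    with zero differential alike. *)
Variables (E : dmod S a) (kap : {linear cycles E -> M}).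
Hypothesis kap_deg : homdeg 0 kap.
Hypothesis kap_surj : forall m, exists z, kap z = m.
Hypothesis kap_ker : forall z, kap z = 0 <-> exists v, dd v = cyc z.

(** The last two clauses anchor the construction: the leading term of the differential is [d], and
    level [0] realizes the augmentation. *)
Definition good (de : I -> G) (ep : I -> E) (x : I) : Prop :=
  [/\ supp_lt (lv x) (de x), hext gB de (de x) = 0, dd (ep x) = hext gB ep (de x),
      forall i, lv x = i.+1 -> tproj i (de x) = d i (tb T i.+1 x)
    & lv x = 0%N -> exists z, cyc z = ep x /\ kap z = aug (tb T 0 x)].

(* [de] and [ep] are the values on the generators of the differential of [G] and
   of the map to [E]; only those of level less than [p] are constrained. *)
Definition stage (p : nat) (de : I -> G) (ep : I -> E) : Prop :=
  [/\ forall x, gr (hdeg gB x + a) (de x), forall x, gr (hdeg gB x + 0) (ep x)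
    & forall x, (lv x < p)%N -> good de ep x].

Section Stage.
Variables (p : nat) (de : I -> G) (ep : I -> E).
Hypothesis st : stage p de ep.
Local Notation D := (hext gB de).
Local Notation Ep := (hext gB ep).

Lemma stage_good v x : supp_lt p v -> hco gB x v = 0 \/ good de ep x.
Proof.
case: st => _ _ gd pv; case: (leqP p (lv x)) => px; first by left; exact: pv.
by right; exact: gd.
Qed.

Lemma stage_ddK v : supp_lt p v -> D (D v) = 0.
Proof.
move=> pv; apply: (@hb_ext_at _ _ _ gB _ (D \o D) \0) => x.
by case: (stage_good x pv) => [->|[_ e _ _ _]]; [left|right; rewrite /= hextE].
Qed.

Lemma stage_dd v : supp_lt p v -> dd (Ep v) = Ep (D v).
Proof.
move=> pv; apply: (@hb_ext_at _ _ _ gB _ (dd \o Ep) (Ep \o D)) => x.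
by case: (stage_good x pv) => [->|[_ _ e _ _]]; [left|right; rewrite /= !hextE].
Qed.

Lemma stage_tproj i v : (i.+1 < p)%N -> supp_lt i.+2 v ->
  tproj i (D v) = d i (tproj i.+1 v).
Proof.
move=> ip iv; apply: (@hb_ext_at _ _ _ gB _ (tproj i \o D) (d i \o tproj i.+1)) => x.
case: (stage_good x (supp_lt_le ip iv)) => [->|[sx _ _ px _]]; first by left.
case: (ltngtP (lv x) i.+1) => xi; [right|left; exact: iv|right].
  rewrite /= !hextE tb0 ?linear0 ?ltn_eqF //.
  by apply: tproj_sup; apply: supp_lt_le sx.
by rewrite /= !hextE px.
Qed.

Lemma stage_sup q v : (q < p)%N -> supp_lt q.+1 v -> supp_lt q (D v).
Proof.
move=> qp qv y qy; apply: (@hb_ext_at _ _ _ gB _ (hco gB y \o D) \0) => x.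
case: (stage_good x (supp_lt_le qp qv)) => [->|[sx _ _ _ _]]; first by left.
case: (leqP q.+1 (lv x)) => xq; first by left; exact: qv.
by right; rewrite /= hextE; apply: sx; apply: leq_trans qy.
Qed.

Lemma stage_aug v : (0 < p)%N -> supp_lt 1 v ->
  exists z, cyc z = Ep v /\ kap z = aug (tproj 0 v).
Proof.
move=> p0 v1.
have /choice [z zP] x : exists z, (lv x = 0%N -> cyc z = ep x /\ kap z = aug (tb T 0 x)).
  case: (eqVneq (lv x) 0%N) => [x0|/eqP nx]; last by exists 0.
  have [_ _ gd] := st; have [|_ _ _ _ /(_ x0) [z zP]] := gd x; first by rewrite x0.
  by exists z.
exists (\sum_x hco gB x v *: z x); rewrite !hext_sum !linear_sum; split; apply: eq_bigr => x _.
  rewrite linearZ /=; case: (posnP (lv x)) => [/zP [-> _] //|x0].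
  by rewrite v1 ?scale0r.
rewrite !linearZ /=; case: (posnP (lv x)) => [/zP [_ ->] //|x0].
by rewrite v1 ?scale0r.
Qed.

(** The top component of [v] is a cycle of [F], or, at level [0], has zero augmentation because
    [Ep v] bounds; exactness makes it [d u]. Subtracting [D] of [u] lowers the level by one. *)
Lemma stage_boundary q v : (q < p)%N -> supp_lt q v -> D v = 0 ->
  (exists y, dd y = Ep v) -> exists z, supp_lt q.+1 z /\ D z = v.
Proof.
have [augS aug0 dex] := res.
elim: q v => [|q IH] v qp qv Dv [y ey].
  by exists 0; rewrite (supp_lt0 qv) linear0; split=> // x _; exact: linear0.
have [u eu] : exists u, d q u = tproj q v.
  case: q {IH} qp qv => [|q] qp qv; last first.
    by apply/dex; rewrite -stage_tproj ?Dv ?linear0 // ltnW.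
  have [z [ez kz]] := stage_aug (ltnW qp) qv.
  by apply/aug0; rewrite -kz; apply/kap_ker; exists y; rewrite ez.
have su : supp_lt q.+2 (tincl _ u) by exact: supp_lt_tincl.
have [|||z [qz Dz]] := IH (v - D (tincl _ u)) (ltnW qp).
- apply: supp_lt_pred; first by apply: supp_ltB => //; exact: stage_sup.
  by rewrite linearB stage_tproj // tinclK eu subrr.
- by rewrite linearB Dv stage_ddK ?subrr //; exact: supp_lt_le su.
- by exists (y - Ep (tincl _ u)); rewrite !linearB ey stage_dd //; exact: supp_lt_le su.
exists (z + tincl _ u); split; first by apply: supp_ltD => //; exact: supp_lt_le qz.
by rewrite linearD Dz subrK.
Qed.

(** Every class of [M] is the augmentation of an element of [F_0], and level [0] consists of cycles
    of [D]. *)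
Lemma stage_correct v : (0 < p)%N -> dd (Ep v) = 0 ->
  exists (f : G) (y : E), [/\ supp_lt 1 f, D f = 0 & dd y = Ep v - Ep f].
Proof.
have [augS aug0 dex] := res; move=> p0 /cycP [z ez].
have [m em] := augS (kap z).
have sf := @supp_lt_tincl _ m; have [z' [ez' kz']] := stage_aug p0 sf.
have [y ey] : exists y, dd y = cyc (z - z').
  by apply/kap_ker; rewrite linearB kz' tinclK em subrr.
exists (tincl _ m), y; split=> //; first exact/supp_lt0/stage_sup.
by rewrite ey linearB ez ez'.
Qed.

(** This finds the differential of a new generator [x]. Let [w] be [d x] in level [p - 1]. As [d]
    squares to zero, [D w] drops one level more than expected, and [stage_boundary] gives a lower
    [z] with [D z = D w]. Then [stage_correct] supplies [f] in level [0] cancelling the class of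
    [Ep (w - z)]. The leading term is unaffected. *)
Lemma stage_cycle i x : p = i.+1 -> lv x = p ->
  exists (v : G) (y : E),
    [/\ supp_lt p v, D v = 0, dd y = Ep v & tproj i v = d i (tb T i.+1 x)].
Proof.
have [augS aug0 dex] := res; move=> pi xp.
pose w := tincl i (d i (tb T i.+1 x)).
have sw : supp_lt p w by rewrite pi; exact: supp_lt_tincl.
have ip : (i < p)%N by rewrite pi.
case: i pi @w sw ip => [|j] pj w sw ip.
  have [z [ez kz]] := stage_aug ip (eq_ind p (fun p => supp_lt p w) sw _ pj).
  exists w.
  have /kap_ker [y ey] : kap z = 0 by rewrite kz tinclK; apply/aug0; exists (tb T 1 x).
  exists y; split=> //; last exact: tinclK.
    by apply/supp_lt0/stage_sup => //; rewrite -pj.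
  by rewrite ey ez.
have sDw : supp_lt j (D w).
  apply: supp_lt_pred; first by apply: stage_sup; rewrite -?pj //; exact: ltnW.
  rewrite stage_tproj ?pj // -?pj // tinclK; apply/dex.
  by exists (tb T j.+2 x).
have [||z [sz Dz]] := stage_boundary (ltnW ip) sDw.
- exact: stage_ddK sw.
- by exists (Ep w); exact: stage_dd.
have [|f [y [sf Df ey]]] := @stage_correct (w - z) (leq_ltn_trans (leq0n _) ip).
  rewrite linearB linearB !stage_dd ?Dz ?subrr //.
  by apply: supp_lt_le sz; apply: ltnW.
exists (w - z - f), y; split.
- apply: supp_ltB; last by apply: supp_lt_le sf; apply: leq_ltn_trans ip.
  by apply: supp_ltB => //; apply: supp_lt_le sz; exact: ltnW.
- by rewrite !linearB Dz Df subrr subr0.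
- by rewrite ey [in RHS]linearB.
- rewrite !linearB tinclK (tproj_sup sz) subr0 tproj_sup ?subr0 //.
  exact: supp_lt_le sf.
Qed.

End Stage.

Lemma hext_pick (V : gmod S) (p : nat) (t t' : I -> V) v : supp_lt p v ->
  hext gB (fun x => if lv x == p then t' x else t x) v = hext gB t v.
Proof.
move=> pv; rewrite !hext_sum; apply: eq_bigr => x _; case: eqP => // xp.
by rewrite pv ?scale0r // xp.
Qed.

Lemma stage_exists p : exists de ep, stage p de ep.
Proof.
have [augS aug0 dex] := res.
elim: p => [|p [de [ep st]]].
  by exists (fun=> 0), (fun=> 0); split=> // x; exact: gr0.
have [gde gep gd] := st.
have step x : exists vy : G * E, [/\ gr (hdeg gB x + a) vy.1,
    gr (hdeg gB x + 0) vy.2 & lv x = p ->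
    [/\ supp_lt p vy.1, hext gB de vy.1 = 0, dd vy.2 = hext gB ep vy.1,
      forall i, lv x = i.+1 -> tproj i vy.1 = d i (tb T i.+1 x)
    & lv x = 0%N -> exists z, cyc z = vy.2 /\ kap z = aug (tb T 0 x)]].
  case: (eqVneq (lv x) p) => [xp|/eqP nx]; last first.
    by exists (0, 0); split=> //; [exact: (gr0 G)|exact: (gr0 E)].
  (* On level [0] the differential is [0], and the map to [E] takes a cycle representing the
     augmentation. *)
  case: (posnP (lv x)) => [x0|x0].
    have [z kz] := kap_surj (aug (tb T 0 x)).
    exists (0, cyc (mcomp z (tdeg T x))); split=> /=; first exact: (gr0 G).
      by rewrite x0 mul0r subr0 addr0; exact: (mcomp_in z).
    move=> _; split=> [y _|||i|_].
    - exact: linear0.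
    - exact: linear0.
    - by rewrite dd_cyc linear0.
    - by rewrite x0.
    exists (mcomp z (tdeg T x)); split=> //.
    rewrite -(mcomp_hom _ _ kap_deg) addr0 kz; apply: mcomp_id.
    by apply: ghom_deg; exact: tb_gr.
  have pi : p = (lv x).-1.+1 by rewrite -xp prednK.
  have [v [y [sv Dv ey tv]]] := stage_cycle st pi xp.
  set n := hdeg gB x + a; set m := hdeg gB x.
  (* All the conditions are homogeneous, so they survive passing to components. *)
  exists (mcomp v n, mcomp y m); split.
  - exact: (mcomp_in v).
  - by rewrite addr0; exact: (mcomp_in y).
  have hD : homdeg a (hext gB de) by apply: hext_deg.
  have hE : homdeg 0 (hext gB ep) by apply: hext_deg.
  move=> _; split=> /=.
  - exact: supp_lt_mcomp.
  - by rewrite -(mcomp_hom _ _ hD) Dv /mcomp component0.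
  - rewrite -(mcomp_hom _ _ hE) -(mcomp_hom _ _ (@dd_deg _ _ E)) ey.
    by rewrite addr0.
  - move=> i xi; move: tv; rewrite xi => tv.
    rewrite -(mcomp_hom _ _ (@tproj_deg i)) tv.
    apply: mcomp_id.
    have -> : n + i%:Z * a = tdeg T x.
      by rewrite /n /= xi -addrA -[X in _ - _ + (X + _)]mul1r -mulrDl -intS subrK.
    by apply: ghom_deg; exact: tb_gr.
  - by move=> e; rewrite e in x0.
have /choice [f fP] := step.
exists (fun x => if lv x == p then (f x).1 else de x),
  (fun x => if lv x == p then (f x).2 else ep x).
split=> [x|x|x xp].
- by case: eqP => _; have [] := fP x.
- by case: eqP => _; have [] := fP x.
have sx : supp_lt p (if lv x == p then (f x).1 else de x).
  case: eqP => [e|/eqP ne]; first by have [_ _ /(_ e) []] := fP x.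
  have xp' : (lv x < p)%N by rewrite ltn_neqAle ne.
  by have [sx _ _ _ _] := gd _ xp'; exact: supp_lt_le (ltnW xp') sx.
rewrite /good !(hext_pick _ _ sx).
case: eqP sx => [e|/eqP ne] sx; first by have [_ _ /(_ e) []] := fP x; rewrite e.
by apply: gd; rewrite ltn_neqAle ne.
Qed.

Lemma anchored_resolution :
  exists (D : {linear G -> G}) (hD : forall n v, gr n v -> gr (n + a) (D v))
    (DD : forall v, D (D v) = 0) (f : dhom (DMod hD DD) E),
    [/\ quasi_iso f, flag_basis (G := DMod hD DD) gB lv
      & forall i x, lv x = i.+1 -> tproj i (D (gB x)) = d i (tb T i.+1 x)].
Proof.
(* Every element lies in [supp_lt p.-1], and [stage_boundary] needs an index strictly below the
   stage; hence two more than the largest level. *)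
pose p := (\max_x lv x).+2.
have [de [ep st]] := stage_exists p.
have lvp x : (lv x < p)%N by rewrite ltnS leqW // leq_bigmax.
have [gde gep gd] := st.
have spv v : supp_lt p.-1 v by move=> x; rewrite leqNgt ltnS leq_bigmax.
have spv' v : supp_lt p v by exact: supp_lt_le (spv v).
have hD : homdeg a (hext gB de) by apply: hext_deg.
have DD v : hext gB de (hext gB de v) = 0 by exact: stage_ddK st _ (spv' v).
have hE n v : gr n v -> gr n (hext gB ep v).
  by move=> gv; rewrite -[n]addr0; apply: (hext_deg gep).
have ed v : hext gB ep (hext gB de v) = dd (hext gB ep v).
  by rewrite (stage_dd st (spv' v)).
exists (hext gB de), hD, DD,
  (@DHom _ _ (DMod hD DD) E (@GHom _ (DMod hD DD) E (hext gB ep) hE) ed).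
split=> [|x y xy|i x xi].
- apply/quasi_isoP; split=> [v y /= Dv ey|y y0].
    have [|||z [_ Dz]] := stage_boundary st _ (spv v); rewrite //.
      by exists y.
    by exists z.
  have [z ez] := cycP y0; have [augS aug0 dex] := res.
  have [m em] := augS (kap z).
  have sf := @supp_lt_tincl _ m; have [z' [ez' kz']] := stage_aug st isT sf.
  have [t et] : exists y, dd y = cyc (z - z').
    by apply/kap_ker; rewrite linearB kz' tinclK em subrr.
  exists (tincl _ m), t; split=> /=; first exact/supp_lt0/(stage_sup st).
  by rewrite et linearB ez' ez addrC subrK.
- by rewrite /= hextE; have [sx _ _ _ _] := gd x (lvp x); exact: sx.
- by rewrite /= hextE; have [_ _ _ -> //] := gd x (lvp x).
Qed.

End Total.

Section TotalOfBases.
Variables (S : gring) (F : nat -> gmod S) (n : nat -> nat).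
Variables (B : forall i, hbasis (F i) 'I_(n i)) (N : nat).
Hypothesis F0 : forall i (w : F i), (N <= i)%N -> w = 0.

Let I : finType := {p : 'I_N & 'I_(n p)}.

Let mk (p : 'I_N) (l : 'I_(n p)) : I := existT _ p l.

(** The index of [x] within the basis of [F i] when [x] has level [i], transported along the
    equality of levels. *)
Definition tcast (i : nat) (x : I) : option 'I_(n i) :=
  if val (tag x) =P i is ReflectT e then Some (cast_ord (congr1 n e) (tagged x))
  else None.

Lemma tcast_id (x : I) : tcast (val (tag x)) x = Some (tagged x).
Proof.
rewrite /tcast; case: eqP => // e; congr Some; exact/val_inj.
Qed.

Lemma tcast_none i (x : I) : val (tag x) != i -> tcast i x = None.
Proof. by rewrite /tcast; case: eqP. Qed.

(** As [F i] vanishes from [N] on, the disjoint union of the bases below [N] is finite. *)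
Lemma total_basis_exists : exists T : total_basis F I,
  forall x, tlv T x = val (tag x) /\ tdeg T x = hdeg (B (tag x)) (tagged x).
Proof.
pose tb i (x : I) : F i := if tcast i x is Some l then B i l else 0.
pose tco i (x : I) : {linear F i -> S^o} := if tcast i x is Some l then hco (B i) l else \0.
have tb0 i x : val (tag x) != i -> tb i x = 0 by rewrite /tb => /tcast_none ->.
have tco0 i x w : val (tag x) != i -> tco i x w = 0 by rewrite /tco => /tcast_none ->.
have ex i w : w = \sum_x tco i x w *: tb i x.
  case: (leqP N i) => iN.
    by rewrite [LHS]F0 // big1 // => x _; rewrite (F0 w iN) linear0 scale0r.
  pose p := Ordinal iN; pose f (q : 'I_N) (l : 'I_(n q)) : F i :=
    tco i (@mk q l) w *: tb i (@mk q l).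
  transitivity (\sum_(q < N) \sum_(l < n q) f q l).
    rewrite (bigD1 p) //= [X in _ + X]big1 => [|q qp]; last first.
      by apply: big1 => l _; rewrite /f tco0 ?scale0r.
    rewrite addr0 [LHS](hb_expand (B i)); apply: eq_bigr => l _.
    by rewrite /f /tco /tb (tcast_id (@mk p l)).
  by rewrite sig_big_dep; apply: eq_big => -[].
have de i x y : val (tag x) = i -> tco i y (tb i x) = (x == y)%:R.
  move=> <-; rewrite /tb tcast_id /tco.
  case: (eqVneq (tag y) (tag x)) => [|ne]; last first.
    have -> : (x == y) = false by apply: contraNF ne => /eqP ->.
    by rewrite tcast_none ?val_eqE.
  case: x y => [p l] [q k] /= e; move: k; rewrite e => k.
  rewrite (tcast_id (@mk p k)) hco_basis.
  by congr ((_ : bool)%:R); apply/esym; exact: eq_Tagged.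
have ge i (x : I) : gr (hdeg (B (tag x)) (tagged x)) (tb i x).
  case: (eqVneq (val (tag x)) i) => [<-|xi]; last by rewrite tb0 //; exact: gr0.
  by rewrite /tb tcast_id; exact: hb_gr.
by exists (TotalBasis tb0 tco0 ex de ge).
Qed.

End TotalOfBases.

(** * Minimality of anchored resolutions *)

Section Minimality.
Variables (S : glring).

(** The degree [0] component of [c] is zero, hence not a unit; a coefficient outside the maximal
    ideal thus forces degrees to match. *)
Lemma hgr_maxid n (c : S) : hgr n c -> n != 0 -> c \in maxid_ideal S.
Proof.
case: n => [[|m]|m] //= gc _; last by rewrite gc rpred0.
apply/asboolP; rewrite /rcomp (component_hom _ _ gc) => -[_ [y _]] /eqP.
by rewrite mul0r eq_sym oner_eq0.
Qed.

Lemma maxid_submod_coord (V : gmod S) (I : finType) (B : hbasis V I) (v : V) :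
  (forall x, (hco B x v : S) \in maxid_ideal S) -> v \in maxid_submod V.
Proof.
move=> cm; rewrite (hb_expand B v); apply: rpred_sum => x _; apply/asboolP.
exists [:: (hco B x v : S, B x)]; rewrite big_seq1; split=> // p.
by rewrite inE => /eqP -> /=.
Qed.

(** A coefficient of [D] is zero if the level does not drop, an entry of the minimal [d] if it drops
    by one, and of nonzero degree by hypothesis if it drops further. *)
Lemma anchored_minimal (F : nat -> gmod S) (I : finType) (T : total_basis F I) (a : int)
    (d : forall i, ghom (F i.+1) (F i))
    (D : {linear total_mod T a -> total_mod T a})
    (hD : forall n v, gr n v -> gr (n + a) (D v)) (DD : forall v, D (D v) = 0) :
  (forall i (x : residue (F i.+1)), residue_map (d i) x = 0) ->
  flag_basis (G := DMod hD DD) (total_hbasis T a) (tlv T) ->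
  (forall i x, tlv T x = i.+1 ->
    tproj T a i (D (total_hbasis T a x)) = d i (tb T i.+1 x)) ->
  (forall x y, ((tlv T y).+1 < tlv T x)%N ->
    hdeg (total_hbasis T a) x + a <> hdeg (total_hbasis T a) y) ->
  minimal (DMod hD DD).
Proof.
move=> dmin hB hd nodeg x; have [v ->] := residue_pi_surj x.
rewrite /= /residue_dd residue_mapE; apply/residue_pi_eq0.
set gB := total_hbasis T a.
rewrite /dd (hb_expand gB v) linear_sum; apply: rpred_sum => y _.
rewrite linearZ; apply: rpredZ; apply: (maxid_submod_coord (B := gB)) => z.
case: (leqP (tlv T y) (tlv T z)) => yz; first by rewrite [hco _ _ _](hB y z yz) rpred0.
case: (ltngtP (tlv T z).+1 (tlv T y)) yz => // [yz _|yz _]; last first.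
  rewrite -(tco_tproj _ (erefl (tlv T z))) hd //; apply: linear_maxid.
  by apply/residue_pi_eq0; rewrite -residue_mapE.
have gz := hco_gr gB z (hD _ _ (hb_gr gB y)).
by apply: (hgr_maxid gz); rewrite subr_eq0; apply/eqP; exact: nodeg.
Qed.

(** The module is itself the flag, with the identity as split injection. *)
Lemma flag_minimal_resolution (a : int) (G D : dmod S a) (f : dhom G D)
    (I : finType) (B : hbasis G I) (lv : I -> nat) :
  quasi_iso f -> flag_basis B lv -> minimal G -> minimal_free_resolution f.
Proof.
move=> qf hB mG; split=> //.
  by apply: (hbasis_graded_free (B := B) (A := xpredT)) => v; split.
pose id1 : dhom G G := @DHom _ _ G G (@GHom _ G G idfun (fun n v => id)) (fun=> erefl).
exists G, id1, id1, f; split=> //; first exact: hbasis_fin_gen B.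
exact: flag_basis_free_flag hB.
Qed.

End Minimality.

Section HomologyModel.
Variables (S : gring) (a : int) (D : dmod S a) (M : gmod S).

Definition homology_model (E : dmod S a) (kap : {linear cycles E -> M}) : Prop :=
  [/\ homdeg 0 kap, forall m, exists z, kap z = m
    & forall z, kap z = 0 <-> exists v, dd v = cyc z].

Variables (f : ghom (homology D) M) (fbij : bijective f).

Lemma homology_model_iso : homology_model (f \o @homology_class _ _ D).
Proof.
have [g fK gK] := fbij; split=> [n z gz|m|z] /=.
- by rewrite addr0; apply: ghom_deg; exists z.
- by have [z ez] := homology_class_surj (g m); exists z; rewrite -ez gK.
- split=> [fz|[v ev]].
    have : homology_class z = homology_class (0 : cycles D).
      by apply: (can_inj fK); rewrite fz !linear0.
    by move=> /homology_class_eq [v ev]; exists v; rewrite ev !linear0 addr0.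
  suff -> : homology_class z = homology_class (0 : cycles D) by rewrite !linear0.
  by apply/homology_class_eq; exists v; rewrite ev !linear0 addr0.
Qed.

Lemma homology_model_zero :
  homology_model (f \o @cyc _ _ (zero_dmod a (homology D))).
Proof.
have [g fK gK] := fbij; split=> [n z gz|m|z] /=.
- by rewrite addr0; apply: ghom_deg.
- have [z ez] := cycP (D := zero_dmod a (homology D)) (v := g m) erefl.
  by exists z; rewrite ez gK.
- split=> [fz|[v <-]]; last exact: linear0.
  by exists 0; apply: (can_inj fK); rewrite fz linear0.
Qed.

End HomologyModel.

(** * Comparison of total Betti numbers and conclusion *)

Lemma fin_sum_le (I : eqType) (w w' : I -> nat) (b b' : nat) :
  fin_sum w b -> fin_sum w' b' -> (forall i, (w i <= w' i)%N) -> (b <= b')%N.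
Proof.
move=> [s [us zs ->]] [s' [us' zs' ->]] ww'.
have ni i : i \notin undup (s ++ s') -> (i \notin s) * (i \notin s').
  by rewrite mem_undup mem_cat negb_or => /andP[-> ->].
rewrite (@fin_sum_eq _ _ w s (undup (s ++ s'))) ?undup_uniq //; last first.
  by move=> i /ni h; rewrite zs ?h.
rewrite (@fin_sum_eq _ _ w' s' (undup (s ++ s'))) ?undup_uniq //; last first.
  by move=> i /ni h; rewrite zs' ?h.
by elim/big_rec2: _ => // i x y _ xy; exact: leq_add.
Qed.

(** The resolutions witnessing the Betti numbers may vary with [j], so in each degree the residues
    are embedded along [F'], [G'], [G], [F]. *)
Lemma total_betti_le (S : glring) (a : int) (D D' G G' : dmod S a)
    (f : dhom G D) (f' : dhom G' D')
    (t : {linear residue_gmod G' -> residue_gmod G}) (b b' : nat) :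
  minimal_free_resolution f -> minimal_free_resolution f' ->
  injective t -> homdeg 0 t ->
  has_total_betti D b -> has_total_betti D' b' -> (b' <= b)%N.
Proof.
move=> rf rf' tI dt [be [hbe sbe]] [be' [hbe' sbe']].
apply: fin_sum_le sbe' sbe _ => j.
have [F [g [rg [e eb]]]] := hbe j; have [F' [g' [rg' [e' eb']]]] := hbe' j.
have [t1 [t1I dt1]] := residue_embed rg' rf'.
have [t2 [t2I dt2]] := residue_embed rf rg.
have [_ _ mF _] := rg; have [_ _ mF' _] := rg'.
apply: (betti_le (t := t2 \o (t \o t1)) mF' mF) eb' eb.
  by apply: inj_comp => //; exact: inj_comp.
move=> n v gv; rewrite addr0 -[n]addr0 -[n + 0]addr0 -[n + 0 + 0]addr0.
by apply/dt2/dt/dt1.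
Qed.

Lemma homogeneous_hbasis (S : gring) (V : gmod S) n (e : 'I_n -> V) (deg : 'I_n -> int) :
  homogeneous_basis [set: V] e deg ->
  exists B : hbasis V 'I_n, forall l, hdeg B l = deg l.
Proof.
move=> [[_ eV] ge].
have [v|c c0|B [_ Bd]] := hbasis_intro (e := e) (deg := deg) _ _ ge; last by exists B.
  by have [c [ev _]] := eV v Logic.I; exists c.
move=> l; have [c' [_ cu]] := eV 0 Logic.I.
have d0 : c' = [ffun=> 0].
  by apply: cu; rewrite big1 // => k _; rewrite ffunE scale0r.
have /(congr1 (fun f : {ffun _} => f l)) : c' = [ffun l => c l].
  by apply: cu; apply: (etrans (esym c0)); apply: eq_bigr => k _; rewrite ffunE.
by rewrite d0 !ffunE.
Qed.

Lemma anchored_minimal_resolution (S : glring) (M : gmod S) (a : int)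
    (F : nat -> gmod S) (I : finType) (T : total_basis F I)
    (d : forall i, ghom (F i.+1) (F i)) (aug : ghom (F 0%N) M)
    (E : dmod S a) (kap : {linear cycles E -> M}) :
  resolves (F := fun i => F i : lmodType S) (fun i => ghom_fun (d i)) aug ->
  (forall i (x : residue (F i.+1)), residue_map (d i) x = 0) ->
  (forall x y, ((tlv T y).+1 < tlv T x)%N ->
    hdeg (total_hbasis T a) x + a <> hdeg (total_hbasis T a) y) ->
  homology_model kap ->
  exists (D : {linear total_mod T a -> total_mod T a})
    (hD : forall n v, gr n v -> gr (n + a) (D v)) (DD : forall v, D (D v) = 0)
    (f : dhom (DMod hD DD) E), minimal_free_resolution f.
Proof.
move=> res dmin nodeg [kd ks kk].
have [D [hD [DD [f [qf hB hd]]]]] := anchored_resolution T res kd ks kk.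
exists D, hD, DD, f; apply: (flag_minimal_resolution qf hB).
exact: anchored_minimal dmin hB hd nodeg.
Qed.

Theorem theorem4p16 (S : glring) (M : gmod S) (a : int)
    (hM : fin_gen M) (hpd : finite_proj_dim M)
    (hD : exists D : dmod S a,
        [/\ fin_gen D, betti_deficient D & gmod_isom (homology D) M])
    (B : nat -> int -> nat) (hB : graded_betti M B) :
  exists (i i' : nat) (r r' : int) (j : nat),
    [/\ (i.+1 < i')%N, betti_table B i r != 0%N, betti_table B i' r' != 0%N,
        (2 <= j)%N
      & line_slope i r i' r' = 1 - a%:~R + a%:~R / j%:R].
Proof.
have [F [d [aug [res dmin bas]]]] := hB.
(* Bases in which the degree of each element is a nonzero entry of column [i]. *)
have bs i : exists t : {n : nat & hbasis (F i) 'I_n},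
    forall l, B i (hdeg (tagged t) l) != 0%N.
  have [n [e [deg [he Bk]]]] := bas i; have [b bd] := homogeneous_hbasis he.
  exists (Tagged (fun n => hbasis (F i) 'I_n) b) => l /=.
  rewrite Bk -lt0n; apply/card_gt0P; exists l.
  by rewrite inE bd.
pose t i := sval (cid (bs i)); have tP i := svalP (cid (bs i)).
have [N F0] := minimal_resolution_finite (fun i => tagged (t i)) res dmin hpd.
have [T TP] := total_basis_exists (fun i => tagged (t i)) F0.
apply: contrapT => noslope.
have BT x : B (tlv T x) (tdeg T x) != 0%N.
  by have [-> ->] := TP x; exact: tP.
have nodeg x y : ((tlv T y).+1 < tlv T x)%N ->
    hdeg (total_hbasis T a) x + a <> hdeg (total_hbasis T a) y.
  move=> yx /= e; apply: noslope.
  exists (tlv T y), (tlv T x), (tdeg T y - (tlv T y)%:Z), (tdeg T x - (tlv T x)%:Z).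
  exists (tlv T x - tlv T y)%N; rewrite /betti_table !subrK; split=> //; first by lia.
  set j := (tlv T x - tlv T y)%N.
  have j0 : (0 < j)%N by rewrite /j; lia.
  have xE : tlv T x = (tlv T y + j)%N by rewrite /j; lia.
  rewrite /line_slope xE PoszD.
  (* Equality of degrees in [G] says that the internal degrees differ by [(j - 1) * a]; passing to
     rows subtracts [j], and dividing by [- j] gives the slope. *)
  have -> : tdeg T x - ((tlv T y)%:Z + j%:Z) - (tdeg T y - (tlv T y)%:Z) =
      (j%:Z - 1) * a - j%:Z.
    move: e; rewrite xE PoszD => /(canRL (addrK _)) /(canRL (subrK _)) ->.
    by ring.
  rewrite [X in _ / X%:~R]addrAC subrr add0r rmorphB rmorphM rmorphB /= -!pmulrn.
  field; by rewrite pnatr_eq0 -lt0n.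
have [D [_ [b [b' [hb hb' bb]]] [f fbij]]] := hD.
have [G [hG [GG [g rg]]]] :=
  anchored_minimal_resolution res dmin nodeg (homology_model_iso fbij).
have [G' [hG' [GG' [g' rg']]]] :=
  anchored_minimal_resolution res dmin nodeg (homology_model_zero fbij).
(* Both resolutions have the same underlying graded module, so the identity compares their residues,
   contradicting deficiency. *)
pose R := residue_gmod (total_mod T a); pose u : {linear R -> R} := idfun.
have du : homdeg 0 u by move=> n v; rewrite addr0.
have := @total_betti_le _ _ _ _ (DMod hG GG) (DMod hG' GG') _ _ u _ _ rg rg'
  (fun _ _ => id) du hb hb'.
by rewrite leqNgt bb.
Qed.
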